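(* If in a commutative triangle of $\infty\text{-}\mathrm{Cat}$ two of the three arrows are polygraphic equivalences, then so is the third.
   Context: **$\infty$-categories.** All $\infty$-categories are small strict $\infty$-categories and all $\infty$-functors are strict; no invertibility of cells is assumed. $\infty\text{-}\mathrm{Cat}$ is their category. For an $\infty$-category $X$, $X_n$ is the set of $n$-cells (objects if $n=0$); for $x\in X_n$, $0\le i\le n$, $s_ix,t_ix\in X_i$ are the iterated $i$-source and $i$-target ($s_nx=x=t_nx$), $1_x$ is the unit of $x$; if $t_ix_0=s_ix_1$, $x_1*_ix_0$ is the $i$-composite ($x_0$ followed by $x_1$). A $1$-category is viewed as an $\infty$-category with only unit $i$-cells for $i>1$. $X^\circ$ is the total dual (all $i$-cells, $i>0$, reversed). The fundamental category $c_1(X)$ has the objects of $X$ and as arrows the $1$-cells of $X$, two being identified when connected by a zigzag of $2$-cells; the fundamental groupoid $\Pi_1(X)$ is obtained from $c_1(X)$ by formally inverting all arrows. **Local systems.** A local system on $X$ is an $\infty$-functor $M:X^\circ\to\mathrm{Ab}$ ($\mathrm{Ab}$ the $1$-category of abelian groups), given by groups $M_x$ for objects $x$ and contravariantly functorial morphisms $x^*:M_{x_1}\to M_{x_0}$ for $1$-cells $x:x_0\to x_1$, such that all $x^*$ are isomorphisms. For $f:X'\to X$, $f^*(M)=M\circ f^\circ$. **The complex.** $\mathrm{C}(X,M)$ is the chain complex with $\mathrm{C}_n(X,M)=\bigoplus_{x\in X_n}M_{t_0x}/\sim_n$, where $\sim_n$ is the smallest equivalence relation compatible with addition such that $(x_1*_0x_0,m)\sim_n(x_1,m)+(x_0,t_1(x_1)^*(m))$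 and, for $0<i<n$, $(x_1*_ix_0,m)\sim_n(x_1,m)+(x_0,m)$, whenever these composites of $n$-cells make sense (no relation if $n=0$); $d_1(x,m)=(t_0x,m)-(s_0x,x^*m)$, $d_n(x,m)=(t_{n-1}x,m)-(s_{n-1}x,m)$ for $n>1$. An $\infty$-functor $f:X'\to X$ induces $\mathrm{C}(f,M):\mathrm{C}(X',f^*(M))\to\mathrm{C}(X,M)$, $(x',m)\mapsto(f(x'),m)$. **Polygraphic homology and polygraphic equivalences.** The folk model structure on $\infty\text{-}\mathrm{Cat}$ (Lafont–Métayer–Worytkiewicz) has cofibrations generated by the inclusions $i_n:S^{n-1}\hookrightarrow D_n$, $n\ge 0$, where $D_n$ is the $n$-category with exactly one non-trivial $n$-cell $\zeta_n$ and exactly two non-trivial $i$-cells $s_i\zeta_n,t_i\zeta_n$ for $0\le i<n$, and $S^{n-1}$ is $D_n$ with $\zeta_n$ removed; trivial fibrations are the maps with the right lifting property with respect to the $i_n$, and cofibrant objects are the polygraphs. A polygraphic resolution of $X$ is a trivial fibration $p:P\to X$ with $P$ a polygraph. One sets $\mathrm{H}^{\mathrm{pol}}_n(X,M)=\mathrm{H}_n(\mathrm{C}(P,p^*(M)))$, independent of the resolution up to canonical isomorphism. For $f:X'\to X$, resolutions $p',p$ and a lift $\tilde f:P'\to P$ with $p\tilde f=fp'$, $\mathrm{H}^{\mathrm{pol}}_n(f,M):\mathrm{H}^{\mathrm{pol}}_n(X',f^*(M))\to\mathrm{H}^{\mathrm{pol}}_n(X,M)$ is induced by $\mathrm{C}(\tilde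 f,p^*(M))$. An $\infty$-functor $f:X'\to X$ is a polygraphic equivalence if $\Pi_1(f)$ is an equivalence of groupoids and $\mathrm{H}^{\mathrm{pol}}_n(f,M)$ is an isomorphism for every local system $M$ on $X$ and every $n\ge0$. *)

(* Defs.v *)
From HB Require Import structures.
From Stdlib Require Import Relation_Operators RelationClasses.
From mathcomp Require Import all_boot all_algebra zify.
From mathcomp Require Import finmap boolp classical_sets cardinality fsbigop.

Set Implicit Arguments.
Unset Strict Implicit.
Unset Printing Implicit Defensive.

Import GRing.Theory.

Local Open Scope nat_scope.

(* Strict oo-categories.  [src h x] and [tgt h x], for [h : i <= n], are the  *)
(* iterated i-source and i-target of the n-cell x; [iunit h x] is the unit of *)
(* the i-cell x iterated up to dimension n; [comp h x1 x0 e] is x1 *_i x0     *)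
(* (x0 followed by x1).  In the laws, the proofs of composability on both     *)
(* sides are universally quantified, to spare the user any transport.         *)
Record oocat : Type := OoCat {
  cell : nat -> Type;
  src : forall i n : nat, i <= n -> cell n -> cell i;
  tgt : forall i n : nat, i <= n -> cell n -> cell i;
  iunit : forall i n : nat, i <= n -> cell i -> cell n;
  comp : forall (i n : nat) (h : i < n) (x1 x0 : cell n),
    tgt (ltnW h) x0 = src (ltnW h) x1 -> cell n;
  src_id : forall n (h : n <= n) (x : cell n), src h x = x;
  tgt_id : forall n (h : n <= n) (x : cell n), tgt h x = x;
  src_src : forall i j n (hij : i <= j) (hjn : j <= n) (hin : i <= n) x,
    src hij (src hjn x) = src hin x;
  tgt_tgt : forall i j n (hij : i <= j) (hjn : j <= n) (hin : i <= n) x,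
    tgt hij (tgt hjn x) = tgt hin x;
  src_tgt : forall i j n (hij : i < j) (hjn : j <= n) (hin : i <= n) x,
    src (ltnW hij) (tgt hjn x) = src hin x;
  tgt_src : forall i j n (hij : i < j) (hjn : j <= n) (hin : i <= n) x,
    tgt (ltnW hij) (src hjn x) = tgt hin x;
  unit_id : forall n (h : n <= n) (x : cell n), iunit h x = x;
  unit_unit : forall i j n (hij : i <= j) (hjn : j <= n) (hin : i <= n) x,
    iunit hjn (iunit hij x) = iunit hin x;
  src_unit : forall i n (h : i <= n) (x : cell i), src h (iunit h x) = x;
  tgt_unit : forall i n (h : i <= n) (x : cell i), tgt h (iunit h x) = x;
  src_comp : forall i n (h : i < n) x1 x0 e,
    src (ltnW h) (@comp i n h x1 x0 e) = src (ltnW h) x0;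
  tgt_comp : forall i n (h : i < n) x1 x0 e,
    tgt (ltnW h) (@comp i n h x1 x0 e) = tgt (ltnW h) x1;
  src_comp_gt : forall i j n (hij : i < j) (hjn : j <= n) (h : i < n)
      x1 x0 e e',
    src hjn (@comp i n h x1 x0 e) = @comp i j hij (src hjn x1) (src hjn x0) e';
  tgt_comp_gt : forall i j n (hij : i < j) (hjn : j <= n) (h : i < n)
      x1 x0 e e',
    tgt hjn (@comp i n h x1 x0 e) = @comp i j hij (tgt hjn x1) (tgt hjn x0) e';
  comp_assoc : forall i n (h : i < n) x2 x1 x0 e21 e10 e21_0 e2_10,
    @comp i n h (@comp i n h x2 x1 e21) x0 e21_0 =
    @comp i n h x2 (@comp i n h x1 x0 e10) e2_10;
  comp_unitr : forall i n (h : i < n) x e,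
    @comp i n h x (iunit (ltnW h) (src (ltnW h) x)) e = x;
  comp_unitl : forall i n (h : i < n) x e,
    @comp i n h (iunit (ltnW h) (tgt (ltnW h) x)) x e = x;
  unit_comp : forall i n m (h : i < n) (hnm : n <= m) (h' : i < m) x1 x0 e e',
    iunit hnm (@comp i n h x1 x0 e) =
    @comp i m h' (iunit hnm x1) (iunit hnm x0) e';
  interchange : forall i j n (hij : i < j) (hjn : j < n) (hin : i < n)
      y1 y0 x1 x0 ey ex eyx e1 e0 e10,
    @comp i n hin (@comp j n hjn y1 y0 ey) (@comp j n hjn x1 x0 ex) eyx =
    @comp j n hjn (@comp i n hin y1 x1 e1) (@comp i n hin y0 x0 e0) e10
}.

Arguments src {o} [i n].
Arguments tgt {o} [i n].
Arguments iunit {o} [i n].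
Arguments comp {o} [i n] h x1 x0 e.
Arguments src_comp {o} [i n] h [x1 x0] e.
Arguments tgt_comp {o} [i n] h [x1 x0] e.
Arguments src_comp_gt {o} [i j n] hij hjn [h x1 x0] e e'.
Arguments tgt_comp_gt {o} [i j n] hij hjn [h x1 x0] e e'.
Arguments comp_unitr {o} [i n] h x e.
Arguments comp_unitl {o} [i n] h x e.

Definition s0 (X : oocat) (n : nat) (x : cell X n) : cell X 0 := src (leq0n n) x.
Definition t0 (X : oocat) (n : nat) (x : cell X n) : cell X 0 := tgt (leq0n n) x.

Record oofunctor (X Y : oocat) : Type := OoFunctor {
  fmap :> forall n : nat, cell X n -> cell Y n;
  fmap_src : forall i n (h : i <= n) x, fmap (src h x) = src h (fmap x);
  fmap_tgt : forall i n (h : i <= n) x, fmap (tgt h x) = tgt h (fmap x);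
  fmap_unit : forall i n (h : i <= n) x, fmap (iunit h x) = iunit h (fmap x);
  fmap_comp : forall i n (h : i < n) x1 x0 e e',
    fmap (comp h x1 x0 e) = comp h (fmap x1) (fmap x0) e'
}.
Arguments fmap {X Y} o [n].
Arguments fmap_comp {X Y} o [i n h x1 x0].

Definition oofunctor_eq (X Y : oocat) (F G : oofunctor X Y) : Prop :=
  forall (n : nat) (x : cell X n), F n x = G n x.

Section FunctorComposition.
Variables (X Y Z : oocat) (G : oofunctor Y Z) (F : oofunctor X Y).

Let gf n (x : cell X n) : cell Z n := G n (F n x).

Let gf_src i n (h : i <= n) x : gf (src h x) = src h (gf x).
Proof. by rewrite /gf !fmap_src. Qed.

Let gf_tgt i n (h : i <= n) x : gf (tgt h x) = tgt h (gf x).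
Proof. by rewrite /gf !fmap_tgt. Qed.

Let gf_unit i n (h : i <= n) x : gf (iunit h x) = iunit h (gf x).
Proof. by rewrite /gf !fmap_unit. Qed.

Let gf_comp i n (h : i < n) x1 x0 e e' :
  gf (comp h x1 x0 e) = comp h (gf x1) (gf x0) e'.
Proof.
have e1 : tgt (ltnW h) (F n x0) = src (ltnW h) (F n x1).
  by rewrite -fmap_tgt -fmap_src e.
by rewrite /gf (fmap_comp F _ e1) (fmap_comp G _ e').
Qed.

Definition oocomp : oofunctor X Z := OoFunctor gf_src gf_tgt gf_unit gf_comp.

End FunctorComposition.

(* The globes D_n and the spheres S^(n-1).  A non-trivial cell is a pair      *)
(* (k, b) of its dimension and a boolean: (i, false) and (i, true), i < n,    *)
(* are s_i zeta_n and t_i zeta_n, and (n, false) is zeta_n.  An m-cell is a   *)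
(* non-trivial cell of dimension at most m, standing for its iterated unit.   *)
(* Both cases are handled at once by means of a predicate V selecting the     *)
(* non-trivial cells.                                                         *)
Section Globe.
Variable V : pred (nat * bool).
Hypothesis Vdown : forall k b i c, V (k, b) -> i < k -> V (i, c).

Definition gcell (m : nat) : Type := {c : nat * bool | V c && (c.1 <= m)}.

Definition gbd_val (b : bool) (i : nat) (c : nat * bool) : nat * bool :=
  if c.1 <= i then c else (i, b).

Lemma gbd_subproof b i m (h : i <= m) (c : gcell m) :
  V (gbd_val b i (val c)) && ((gbd_val b i (val c)).1 <= i).
Proof.
case: c => [[k a] /= /andP[Vk km]]; rewrite /gbd_val /=.
case: leqP => [ki|ik] /=; first by rewrite Vk ki.
by rewrite (Vdown _ Vk ik) leqnn.
Qed.

Definition gbd b i m (h : i <= m) (c : gcell m) : gcell i :=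
  exist (fun c => V c && (c.1 <= i)) _ (gbd_subproof b h c).

Lemma gunit_subproof i m (h : i <= m) (c : gcell i) :
  V (val c) && ((val c).1 <= m).
Proof. by case: c => [c /= /andP[-> ci]]; exact: leq_trans ci h. Qed.

Definition gunit i m (h : i <= m) (c : gcell i) : gcell m :=
  exist (fun c => V c && (c.1 <= m)) _ (gunit_subproof h c).

(* One of two i-composable cells is the iterated unit of an i-cell.           *)
Definition gcomp i m (h : i < m) (c1 c0 : gcell m)
    (_ : gbd true (ltnW h) c0 = gbd false (ltnW h) c1) : gcell m :=
  if (val c0).1 <= i then c1 else c0.

Let gcompE i m (h : i < m) c1 c0 e :
  val (@gcomp i m h c1 c0 e) = if (val c0).1 <= i then val c1 else val c0.
Proof. by rewrite /gcomp; case: ifP. Qed.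

Local Ltac globe_norm :=
  rewrite /= ?gcompE /=;
  repeat match goal with
  | H : @eq (gcell _) _ _ |- _ =>
      move/(congr1 val): H; rewrite /= ?gcompE /=
  end;
  repeat match goal with
  | x : gcell _ |- _ => case: x => [[? ?] /= /andP[_ ?]]
  end; rewrite /gbd_val /=.
Local Ltac globe_case :=
  repeat match goal with
  | H : context [if ?b then _ else _] |- _ =>
      lazymatch b with context [if _ then _ else _] => fail
      | _ => destruct b eqn:?; simpl in * end
  | |- context [if ?b then _ else _] =>
      lazymatch b with context [if _ then _ else _] => fail
      | _ => destruct b eqn:?; simpl in * end
  | H : (_, _) = (_, _) |- _ => injection H as ? ?; subst
  end.
Local Ltac globe :=
  intros; apply: val_inj; globe_norm; intros; globe_case;
  try congruence; try lia; try (by congr (_, _); lia).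

Definition globular : oocat.
Proof.
refine (@OoCat gcell (gbd false) (gbd true) gunit gcomp
  _ _ _ _ _ _ _ _ _ _ _ _ _ _ _ _ _ _ _).
all: abstract globe.
Defined.

End Globe.

Section GlobeInclusion.
Variables V W : pred (nat * bool).
Hypothesis Vdown : forall k b i c, V (k, b) -> i < k -> V (i, c).
Hypothesis Wdown : forall k b i c, W (k, b) -> i < k -> W (i, c).
Hypothesis VW : forall c, V c -> W c.

Let inclP m (c : gcell V m) : W (val c) && ((val c).1 <= m).
Proof. by case: c => [c /= /andP[/VW -> ->]]. Qed.

Let incl m (c : gcell V m) : gcell W m :=
  exist (fun c => W c && (c.1 <= m)) _ (inclP c).

Definition globular_incl : oofunctor (globular Vdown) (globular Wdown).
Proof.
refine (@OoFunctor (globular Vdown) (globular Wdown) incl _ _ _ _).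
all: abstract (intros; apply: val_inj => //=; rewrite /gcomp; by case: ifP).
Defined.

End GlobeInclusion.

Definition disk_cell (n : nat) : pred (nat * bool) :=
  fun c => (c.1 < n) || ((c.1 == n) && ~~ c.2).
Definition sphere_cell (n : nat) : pred (nat * bool) := fun c => c.1 < n.

Lemma disk_cell_down n k b i c :
  disk_cell n (k, b) -> i < k -> disk_cell n (i, c).
Proof. rewrite /disk_cell /=; lia. Qed.

Lemma sphere_cell_down n k b i c :
  sphere_cell n (k, b) -> i < k -> sphere_cell n (i, c).
Proof. rewrite /sphere_cell /=; lia. Qed.

Lemma sphere_disk_cell n c : sphere_cell n c -> disk_cell n c.
Proof. by rewrite /sphere_cell /disk_cell => ->. Qed.

Definition disk (n : nat) : oocat := globular (@disk_cell_down n).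

(* [sphere n] is S^(n-1); in particular [sphere 0] is empty.                  *)
Definition sphere (n : nat) : oocat := globular (@sphere_cell_down n).

Definition sphere_incl (n : nat) : oofunctor (sphere n) (disk n) :=
  globular_incl (@sphere_cell_down n) (@disk_cell_down n) (@sphere_disk_cell n).

Definition has_lifting (A B Y Z : oocat)
    (i : oofunctor A B) (q : oofunctor Y Z) : Prop :=
  forall (u : oofunctor A Y) (v : oofunctor B Z),
    oofunctor_eq (oocomp q u) (oocomp v i) ->
    exists w : oofunctor B Y,
      oofunctor_eq (oocomp w i) u /\ oofunctor_eq (oocomp q w) v.

Definition trivial_fibration (Y Z : oocat) (q : oofunctor Y Z) : Prop :=
  forall n : nat, has_lifting (sphere_incl n) q.

(* The cofibrations generated by the inclusions S^(n-1) -> D_n: the maps with *)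
(* the left lifting property against the trivial fibrations.                  *)
Definition cofibration (A B : oocat) (i : oofunctor A B) : Prop :=
  forall (Y Z : oocat) (q : oofunctor Y Z),
    trivial_fibration q -> has_lifting i q.

Definition oo0 : oocat.
Proof.
refine (@OoCat (fun _ => Empty_set) (fun _ _ _ x => x) (fun _ _ _ x => x)
  (fun _ _ _ x => x) (fun _ _ _ x _ _ => x)
  _ _ _ _ _ _ _ _ _ _ _ _ _ _ _ _ _ _ _).
all: by intros; match goal with x : _ |- _ => exact (match (x : Empty_set) with end) end.
Defined.

Definition from_oo0 (X : oocat) : oofunctor oo0 X.
Proof.
refine (@OoFunctor oo0 X (fun _ x => match x with end) _ _ _ _).
all: by intros; match goal with x : _ |- _ => exact (match (x : Empty_set) with end) end.
Defined.

(* The polygraphs are the cofibrant objects of the folk model structure.      *)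
Definition polygraph (P : oocat) : Prop := cofibration (from_oo0 P).

Definition polygraphic_resolution (P X : oocat) (p : oofunctor P X) : Prop :=
  polygraph P /\ trivial_fibration p.

(* Categories whose arrows are compared by an equivalence relation, so that   *)
(* quotients and localizations need no quotient types.                        *)
Record category : Type := Category {
  obj : Type;
  hom : obj -> obj -> Type;
  heq : forall a b : obj, hom a b -> hom a b -> Prop;
  hid : forall a : obj, hom a a;
  hcomp : forall a b c : obj, hom b c -> hom a b -> hom a c;
  heq_equiv : forall a b : obj, Equivalence (@heq a b);
  hcomp_heq : forall (a b c : obj) (g g' : hom b c) (f f' : hom a b),
    heq g g' -> heq f f' -> heq (hcomp g f) (hcomp g' f');
  hcomp_idl : forall (a b : obj) (f : hom a b), heq (hcomp (hid b) f) f;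
  hcomp_idr : forall (a b : obj) (f : hom a b), heq (hcomp f (hid a)) f;
  hcompA : forall (a b c d : obj) (h : hom c d) (g : hom b c) (f : hom a b),
    heq (hcomp (hcomp h g) f) (hcomp h (hcomp g f))
}.

Arguments hom {c0} a b : rename.
Arguments heq {c0} [a b] f g : rename.
Arguments hid {c0} a : rename.
Arguments hcomp {c0} [a b c] g f : rename.

Record functor (C D : category) : Type := Functor {
  fobj :> obj C -> obj D;
  fhom : forall a b : obj C, hom a b -> hom (fobj a) (fobj b);
  fhom_heq : forall (a b : obj C) (f g : hom a b),
    heq f g -> heq (fhom f) (fhom g);
  fhom_id : forall a : obj C, heq (fhom (hid a)) (hid (fobj a));
  fhom_comp : forall (a b c : obj C) (g : hom b c) (f : hom a b),
    heq (fhom (hcomp g f)) (hcomp (fhom g) (fhom f))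
}.
Arguments fhom {C D} F [a b] f : rename.

Definition id_functor (C : category) : functor C C.
Proof.
refine (@Functor C C (fun a => a) (fun _ _ f => f) _ _ _) => //.
- by move=> a; apply: (@Equivalence_Reflexive _ _ (heq_equiv _ _)).
- by move=> *; apply: (@Equivalence_Reflexive _ _ (heq_equiv _ _)).
Defined.

Definition comp_functor (C D E : category) (G : functor D E) (F : functor C D) :
  functor C E.
Proof.
refine (@Functor C E (fun a => G (F a)) (fun _ _ f => fhom G (fhom F f)) _ _ _).
- by move=> a b f g fg; do 2!apply: fhom_heq.
- move=> a; apply: (@Equivalence_Transitive _ _ (heq_equiv _ _)).
    by apply: fhom_heq; apply: fhom_id.
  exact: fhom_id.
- move=> a b c g f; apply: (@Equivalence_Transitive _ _ (heq_equiv _ _)).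
    by apply: fhom_heq; apply: fhom_comp.
  exact: fhom_comp.
Defined.

Definition is_iso (C : category) (a b : obj C) (f : hom a b) : Prop :=
  exists g : hom b a, heq (hcomp g f) (hid a) /\ heq (hcomp f g) (hid b).

Definition naturally_isomorphic (C D : category) (F G : functor C D) : Prop :=
  exists eta : forall a : obj C, hom (F a) (G a),
    (forall a, is_iso (eta a)) /\
    (forall (a b : obj C) (f : hom a b),
       heq (hcomp (eta b) (fhom F f)) (hcomp (fhom G f) (eta a))).

Definition is_equivalence (C D : category) (F : functor C D) : Prop :=
  exists G : functor D C,
    naturally_isomorphic (comp_functor G F) (id_functor C) /\
    naturally_isomorphic (comp_functor F G) (id_functor D).

(* The localization of a category at all its arrows: arrows are formal        *)
(* composites of arrows and formal inverses of arrows.                        *)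
Section Localization.
Variable C : category.

Inductive lhom : obj C -> obj C -> Type :=
| l_arr a b : hom a b -> lhom a b
| l_inv a b : hom a b -> lhom b a
| l_id a : lhom a a
| l_comp a b c : lhom b c -> lhom a b -> lhom a c.

Inductive lhom_eq : forall a b, lhom a b -> lhom a b -> Prop :=
| le_refl a b (f : lhom a b) : lhom_eq f f
| le_sym a b (f g : lhom a b) : lhom_eq f g -> lhom_eq g f
| le_trans a b (f g h : lhom a b) : lhom_eq f g -> lhom_eq g h -> lhom_eq f h
| le_comp a b c (g g' : lhom b c) (f f' : lhom a b) :
    lhom_eq g g' -> lhom_eq f f' -> lhom_eq (l_comp g f) (l_comp g' f')
| le_idl a b (f : lhom a b) : lhom_eq (l_comp (l_id b) f) f
| le_idr a b (f : lhom a b) : lhom_eq (l_comp f (l_id a)) f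
| le_assoc a b c d (h : lhom c d) (g : lhom b c) (f : lhom a b) :
    lhom_eq (l_comp (l_comp h g) f) (l_comp h (l_comp g f))
| le_arr_heq a b (f g : hom a b) : heq f g -> lhom_eq (l_arr f) (l_arr g)
| le_arr_id a : lhom_eq (l_arr (hid a)) (l_id a)
| le_arr_comp a b c (g : hom b c) (f : hom a b) :
    lhom_eq (l_arr (hcomp g f)) (l_comp (l_arr g) (l_arr f))
| le_invl a b (f : hom a b) : lhom_eq (l_comp (l_inv f) (l_arr f)) (l_id a)
| le_invr a b (f : hom a b) : lhom_eq (l_comp (l_arr f) (l_inv f)) (l_id b).

Definition localization : category.
Proof.
refine (@Category (obj C) lhom lhom_eq l_id l_comp _ _ _ _ _).
- by move=> a b; split; [exact: le_refl|exact: le_sym|exact: le_trans].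
- exact: le_comp.
- exact: le_idl.
- exact: le_idr.
- exact: le_assoc.
Defined.

End Localization.

Section LocalizationFunctor.
Variables (C D : category) (F : functor C D).

Fixpoint lmap a b (f : lhom a b) : lhom (F a) (F b) :=
  match f with
  | l_arr _ _ f => l_arr (fhom F f)
  | l_inv _ _ f => l_inv (fhom F f)
  | l_id a => l_id (F a)
  | l_comp _ _ _ g f => l_comp (lmap g) (lmap f)
  end.

Lemma le_inv_heq (E : category) (a b : obj E) (f g : hom a b) :
  heq f g -> lhom_eq (l_inv f) (l_inv g).
Proof.
move=> fg; apply: le_trans (le_sym (le_idr _)) _.
apply: le_trans (le_comp (le_refl _) (le_sym (le_invr g))) _.
apply: le_trans (le_sym (le_assoc _ _ _)) _.
apply: le_trans (le_comp _ (le_refl _)) (le_idl _).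
apply: le_trans (le_comp (le_refl _) _) (le_invl f).
by apply: le_arr_heq; apply: (@Equivalence_Symmetric _ _ (heq_equiv _ _)).
Qed.

Lemma lmap_heq a b (f g : lhom a b) : lhom_eq f g -> lhom_eq (lmap f) (lmap g).
Proof.
elim=> {a b f g} /=.
- by move=> *; apply: le_refl.
- by move=> *; apply: le_sym.
- by move=> a b f g h _ fg _ gh; apply: le_trans fg gh.
- by move=> *; apply: le_comp.
- by move=> *; apply: le_idl.
- by move=> *; apply: le_idr.
- by move=> *; apply: le_assoc.
- by move=> a b f g fg; apply: le_arr_heq; apply: fhom_heq.
- by move=> a; apply: le_trans (le_arr_id _); apply: le_arr_heq; apply: fhom_id.
- move=> a b c g f; apply: le_trans (le_arr_comp _ _).
  by apply: le_arr_heq; apply: fhom_comp.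
- by move=> *; apply: le_invl.
- by move=> *; apply: le_invr.
Qed.

Definition localization_functor :
  functor (localization C) (localization D).
Proof.
refine (@Functor (localization C) (localization D) F lmap _ _ _).
- exact: lmap_heq.
- by move=> a; apply: le_refl.
- by move=> *; apply: le_refl.
Defined.

End LocalizationFunctor.

Section FundamentalCategory.
Variable X : oocat.

Definition arrow (x y : cell X 0) : Type := {f : cell X 1 | s0 f = x /\ t0 f = y}.

Definition two_cell (f g : cell X 1) : Prop :=
  exists a : cell X 2, src (isT : 1 <= 2) a = f /\ tgt (isT : 1 <= 2) a = g.

Definition arrow_eq (x y : cell X 0) (f g : arrow x y) : Prop :=
  clos_refl_sym_trans _ two_cell (proj1_sig f) (proj1_sig g).

Lemma arrow_id_subproof (x : cell X 0) :
  s0 (iunit (leq0n 1) x) = x /\ t0 (iunit (leq0n 1) x) = x.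
Proof. by rewrite /s0 /t0 src_unit tgt_unit. Qed.

Definition arrow_id (x : cell X 0) : arrow x x := exist _ _ (arrow_id_subproof x).

Lemma arrow_comp_subproof1 (x y z : cell X 0) (g : arrow y z) (f : arrow x y) :
  tgt (ltnW (isT : 0 < 1)) (proj1_sig f) = src (ltnW (isT : 0 < 1)) (proj1_sig g).
Proof.
case: g f => [g [sg _]] [f [_ tf]] /=.
by rewrite (bool_irrelevance (ltnW _) (leq0n 1)) [LHS]tf -sg.
Qed.

Lemma arrow_comp_subproof2 (x y z : cell X 0) (g : arrow y z) (f : arrow x y) :
  let gf := comp (isT : 0 < 1) _ _ (arrow_comp_subproof1 g f) in
  s0 gf = x /\ t0 gf = z.
Proof.
move=> gf; rewrite /s0 /t0 (bool_irrelevance (leq0n 1) (ltnW (isT : 0 < 1))).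
rewrite src_comp tgt_comp (bool_irrelevance (ltnW _) (leq0n 1)).
by split; [case: f {gf} => f []|case: g {gf} => g []].
Qed.

Definition arrow_comp (x y z : cell X 0) (g : arrow y z) (f : arrow x y) :
  arrow x z := exist _ _ (arrow_comp_subproof2 g f).

Lemma comp_irr i n (h h' : i < n) (x1 x1' x0 x0' : cell X n) e e' :
  x1 = x1' -> x0 = x0' -> comp h x1 x0 e = comp h' x1' x0' e'.
Proof.
move=> E1 E0; subst; rewrite (bool_irrelevance h' h) in e' *.
by rewrite (Prop_irrelevance e e').
Qed.

Lemma two_cell_ends (f g : cell X 1) : two_cell f g -> s0 f = s0 g /\ t0 f = t0 g.
Proof.
move=> [a [<- <-]]; rewrite /s0 /t0.
rewrite (src_src _ _ (leq0n 2)) (tgt_tgt _ _ (leq0n 2)).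
rewrite (bool_irrelevance (leq0n 1) (ltnW (isT : 0 < 1))).
by rewrite (src_tgt _ _ (leq0n 2)) (tgt_src _ _ (leq0n 2)).
Qed.

Lemma two_cell_unit (f : cell X 1) : two_cell f f.
Proof. by exists (iunit (isT : 1 <= 2) f); rewrite src_unit tgt_unit. Qed.

Lemma two_cell_comp (g g' f f' : cell X 1) (h : 0 < 1) e e' :
  two_cell g g' -> two_cell f f' -> two_cell (comp h g f e) (comp h g' f' e').
Proof.
move=> [b [Eg Eg']] [a [Ef Ef']].
have eba : tgt (ltnW (isT : 0 < 2)) a = src (ltnW (isT : 0 < 2)) b.
  rewrite -(tgt_src h (isT : 1 <= 2)) -(src_src (ltnW h) (isT : 1 <= 2)).
  by rewrite Ef Eg.
exists (comp (isT : 0 < 2) b a eba); split.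
  have e1 : tgt (ltnW h) (src (isT : 1 <= 2) a) =
            src (ltnW h) (src (isT : 1 <= 2) b) by rewrite Ef Eg.
  by rewrite (src_comp_gt _ _ _ e1); apply: comp_irr.
have e1 : tgt (ltnW h) (tgt (isT : 1 <= 2) a) =
          src (ltnW h) (tgt (isT : 1 <= 2) b) by rewrite Ef' Eg'.
by rewrite (tgt_comp_gt _ _ _ e1); apply: comp_irr.
Qed.

Lemma zigzag_ends (f g : cell X 1) :
  clos_refl_sym_trans _ two_cell f g -> s0 f = s0 g /\ t0 f = t0 g.
Proof.
elim=> {f g} [f g /two_cell_ends//|//|f g _ [-> ->]//|].
by move=> f g h _ [-> ->] _ [-> ->].
Qed.

Lemma zigzag_compl (g g' f : cell X 1) (h : 0 < 1) e e' :
  clos_refl_sym_trans _ two_cell g g' ->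
  clos_refl_sym_trans _ two_cell (comp h g f e) (comp h g' f e').
Proof.
move=> gg'; elim: gg' e e' => {g g'}.
- by move=> g g' gg' e e'; apply: rst_step; apply: two_cell_comp (two_cell_unit _).
- by move=> g e e'; rewrite (Prop_irrelevance e e'); apply: rst_refl.
- by move=> g g' _ IH e e'; apply: rst_sym.
- move=> g g1 g' gg1 IH1 _ IH2 e e'.
  have e1 : tgt (ltnW h) f = src (ltnW h) g1.
    rewrite e; have [] := zigzag_ends gg1.
    by rewrite /s0 (bool_irrelevance (leq0n 1) (ltnW h)).
  by apply: rst_trans (IH1 e e1) (IH2 e1 e').
Qed.

Lemma zigzag_compr (g f f' : cell X 1) (h : 0 < 1) e e' :
  clos_refl_sym_trans _ two_cell f f' ->
  clos_refl_sym_trans _ two_cell (comp h g f e) (comp h g f' e').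
Proof.
move=> ff'; elim: ff' e e' => {f f'}.
- by move=> f f' ff' e e'; apply: rst_step; apply: two_cell_comp (two_cell_unit _) _.
- by move=> f e e'; rewrite (Prop_irrelevance e e'); apply: rst_refl.
- by move=> f f' _ IH e e'; apply: rst_sym.
- move=> f f1 f' ff1 IH1 _ IH2 e e'.
  have e1 : tgt (ltnW h) f1 = src (ltnW h) g.
    rewrite -e; have [_] := zigzag_ends ff1.
    by rewrite /t0 (bool_irrelevance (leq0n 1) (ltnW h)).
  by apply: rst_trans (IH1 e e1) (IH2 e1 e').
Qed.

Lemma arrow_comp_idl (x y : cell X 0) (f : arrow x y) :
  proj1_sig (arrow_comp (arrow_id y) f) = proj1_sig f.
Proof.
case: f => [f [sf tf]] /=; set e := arrow_comp_subproof1 _ _.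
have e1 : tgt (ltnW (isT : 0 < 1)) f = src (ltnW (isT : 0 < 1))
    (iunit (ltnW (isT : 0 < 1)) (tgt (ltnW (isT : 0 < 1)) f)).
  by rewrite src_unit.
rewrite -[RHS](comp_unitl _ _ e1); apply: comp_irr => //.
by rewrite -tf /t0 (bool_irrelevance (ltnW _) (leq0n 1)).
Qed.

Lemma arrow_comp_idr (x y : cell X 0) (f : arrow x y) :
  proj1_sig (arrow_comp f (arrow_id x)) = proj1_sig f.
Proof.
case: f => [f [sf tf]] /=; set e := arrow_comp_subproof1 _ _.
have e1 : tgt (ltnW (isT : 0 < 1))
    (iunit (ltnW (isT : 0 < 1)) (src (ltnW (isT : 0 < 1)) f)) =
    src (ltnW (isT : 0 < 1)) f.
  by rewrite tgt_unit.
rewrite -[RHS](comp_unitr _ _ e1); apply: comp_irr => //.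
by rewrite -sf /s0 (bool_irrelevance (ltnW _) (leq0n 1)).
Qed.

Lemma arrow_compA (x y z t : cell X 0)
    (h : arrow z t) (g : arrow y z) (f : arrow x y) :
  proj1_sig (arrow_comp (arrow_comp h g) f) =
  proj1_sig (arrow_comp h (arrow_comp g f)).
Proof. by rewrite /=; apply: comp_assoc. Qed.

Definition c1 : category.
Proof.
refine (@Category (cell X 0) arrow arrow_eq arrow_id arrow_comp _ _ _ _ _).
- by move=> x y; split;
    [move=> f; exact: rst_refl|move=> f g; exact: rst_sym
    |move=> f g h; exact: rst_trans].
- move=> x y z g g' f f' gg' ff'; apply: rst_trans.
    exact: (zigzag_compl _ (arrow_comp_subproof1 g' f) gg').
  exact: zigzag_compr.
- by move=> x y f; rewrite /arrow_eq arrow_comp_idl; exact: rst_refl.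
- by move=> x y f; rewrite /arrow_eq arrow_comp_idr; exact: rst_refl.
- by move=> x y z t h g f; rewrite /arrow_eq arrow_compA; exact: rst_refl.
Defined.

Definition Pi1 : category := localization c1.

End FundamentalCategory.

Section FundamentalFunctor.
Variables (X' X : oocat) (f : oofunctor X' X).

Lemma fmap_s0 n (x : cell X' n) : f 0 (s0 x) = s0 (f n x).
Proof. exact: fmap_src. Qed.

Lemma fmap_t0 n (x : cell X' n) : f 0 (t0 x) = t0 (f n x).
Proof. exact: fmap_tgt. Qed.

Lemma c1_map_subproof (x y : cell X' 0) (a : arrow x y) :
  s0 (f 1 (proj1_sig a)) = f 0 x /\ t0 (f 1 (proj1_sig a)) = f 0 y.
Proof. by case: a => a /= [<- <-]; rewrite fmap_s0 fmap_t0. Qed.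

Definition c1_map (x y : cell X' 0) (a : arrow x y) : arrow (f 0 x) (f 0 y) :=
  exist _ _ (c1_map_subproof a).

Lemma c1_map_eq (x y : cell X' 0) (a b : arrow x y) :
  arrow_eq a b -> arrow_eq (c1_map a) (c1_map b).
Proof.
rewrite /arrow_eq /=; elim=> {a b}.
- move=> _ _ [c [<- <-]]; apply: rst_step.
  by exists (f 2 c); rewrite fmap_src fmap_tgt.
- by move=> a; exact: rst_refl.
- by move=> a b _; exact: rst_sym.
- by move=> a b c _ IHa _ IHb; exact: rst_trans IHa IHb.
Qed.

Definition c1_functor : functor (c1 X') (c1 X).
Proof.
refine (@Functor (c1 X') (c1 X) (f 0) c1_map _ _ _).
- exact: c1_map_eq.
- move=> x; rewrite /= /arrow_eq /= fmap_unit; exact: rst_refl.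
- move=> x y z b a; rewrite /= /arrow_eq /=.
  by rewrite (fmap_comp f _ (arrow_comp_subproof1 (c1_map b) (c1_map a))); exact: rst_refl.
Defined.

Definition Pi1_functor : functor (Pi1 X') (Pi1 X) :=
  localization_functor c1_functor.

End FundamentalFunctor.

Local Open Scope classical_set_scope.
Local Open Scope ring_scope.

Section DirectSum.
Variables (I : Type) (A : I -> zmodType).

Definition dfam : Type := forall i : I, A i.

HB.instance Definition _ := gen_eqMixin dfam.
HB.instance Definition _ := gen_choiceMixin dfam.

Let dfam_add (f g : dfam) : dfam := fun i => f i + g i.
Let dfam_opp (f : dfam) : dfam := fun i => - f i.
Let dfam_zero : dfam := fun i => 0.

Let dfam_addA : associative dfam_add.
Proof. by move=> f g h; apply: functional_extensionality_dep => i; exact: addrA. Qed.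

Let dfam_addC : commutative dfam_add.
Proof. by move=> f g; apply: functional_extensionality_dep => i; exact: addrC. Qed.

Let dfam_add0 : left_id dfam_zero dfam_add.
Proof. by move=> f; apply: functional_extensionality_dep => i; exact: add0r. Qed.

Let dfam_addN : left_inverse dfam_zero dfam_opp dfam_add.
Proof. by move=> f; apply: functional_extensionality_dep => i; exact: addNr. Qed.

HB.instance Definition _ := GRing.isZmodule.Build dfam
  dfam_addA dfam_addC dfam_add0 dfam_addN.

Definition finite_supp (f : dfam) : Prop := finite_set [set i | f i <> 0].

Definition dsum_pred : {pred dfam} := fun f => `[< finite_supp f >].

Lemma dsum_pred_closed : zmod_closed dsum_pred.
Proof.
split.
  apply/asboolP; rewrite /finite_supp; apply: (@sub_finite_set _ _ set0) => //; exact: finite_set0.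
move=> f g /asboolP ff /asboolP fg; apply/asboolP.
have fU : finite_set ([set i | f i <> 0] `|` [set i | g i <> 0]).
  by rewrite finite_setU.
rewrite /finite_supp; apply: (sub_finite_set _ fU) => i /= fgi.
case: (pselect (f i = 0)) => [f0|]; last by left.
case: (pselect (g i = 0)) => [g0|]; last by right.
case: fgi; have -> : (f - g) i = f i - g i by [].
by rewrite f0 g0 subr0.
Qed.

HB.instance Definition _ := GRing.isZmodClosed.Build dfam dsum_pred dsum_pred_closed.

Record dsum : Type := DSum { dsum_val : dfam; _ : dsum_val \in dsum_pred }.

HB.instance Definition _ := [isSub for dsum_val].
HB.instance Definition _ := [Choice of dsum by <:].
HB.instance Definition _ := [SubChoice_isSubZmodule of dsum by <:].

Definition dsum_inj_val (i : I) (a : A i) : dfam := fun j =>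
  if pselect (i = j) is left e then ecast k (A k) e a else 0.

Lemma dsum_inj_subproof (i : I) (a : A i) : dsum_inj_val a \in dsum_pred.
Proof.
apply/asboolP; rewrite /finite_supp; apply: (@sub_finite_set _ _ [set i]); last exact: finite_set1.
by move=> j /=; rewrite /dsum_inj_val; case: pselect.
Qed.

Definition dsum_inj (i : I) (a : A i) : dsum := DSum (dsum_inj_subproof a).

Lemma dsum_injE (i : I) (a : A i) : dsum_val (dsum_inj a) i = a.
Proof.
rewrite /= /dsum_inj_val; case: pselect => // e.
by rewrite (Prop_irrelevance e erefl).
Qed.

Lemma dsum_injE_neq (i j : I) (a : A i) : i <> j -> dsum_val (dsum_inj a) j = 0.
Proof. by rewrite /= /dsum_inj_val; case: pselect. Qed.

Lemma dsum_valP (c c' : dsum) :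
  (forall i, dsum_val c i = dsum_val c' i) -> c = c'.
Proof. by move=> cc'; apply: val_inj; apply: functional_extensionality_dep. Qed.

Lemma dsum_inj_is_zmod_morphism (i : I) : zmod_morphism (@dsum_inj i).
Proof.
move=> a b; apply: dsum_valP => j.
have -> : dsum_val (dsum_inj a - dsum_inj b) j =
  dsum_val (dsum_inj a) j - dsum_val (dsum_inj b) j by [].
case: (pselect (i = j)) => [e|ij]; first by subst j; rewrite !dsum_injE.
by rewrite !dsum_injE_neq // subr0.
Qed.

HB.instance Definition _ (i : I) := GRing.isZmodMorphism.Build (A i) dsum
  (@dsum_inj i) (@dsum_inj_is_zmod_morphism i).

Lemma dsum_supp (c : dsum) : exists X : {fset {classic I}},
  forall i : {classic I}, i \notin X -> dsum_val c i = 0.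
Proof.
have /asboolP := valP c; rewrite /finite_supp => /(@finite_fsetP {classic I})[X XE].
exists X => i iX; apply: contrapT => ci0.
have : [set` X] i by rewrite -XE.
by move=> /= iX'; rewrite iX' in iX.
Qed.

Lemma dsum_decomp (c : dsum) (X : {fset {classic I}}) :
  (forall i : {classic I}, i \notin X -> dsum_val c i = 0) ->
  c = \sum_(i <- X) dsum_inj (dsum_val c i).
Proof.
move=> cX; apply: dsum_valP => j.
have sumE : forall s : seq {classic I}, dsum_val (\sum_(i <- s) dsum_inj (dsum_val c i)) j =
    \sum_(i <- s) dsum_val (dsum_inj (dsum_val c i)) j.
  by elim=> [|i s IH]; rewrite ?big_nil // !big_cons -IH.
rewrite sumE; have [jX|jX] := boolP ((j : {classic I}) \in X).
  rewrite (big_fsetD1 (j : {classic I})) // dsum_injE big_seq big1 => [|i].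
    by rewrite /= addr0.
  by rewrite !inE => /andP[/eqP ij _]; exact: dsum_injE_neq.
rewrite cX // big_seq big1 // => i iX.
by apply: dsum_injE_neq => ij; rewrite -ij iX in jX.
Qed.

Section Lift.
Variables (B : zmodType) (phi : forall i : I, {additive A i -> B}).

Definition dsum_lift (c : dsum) : B :=
  \sum_(i \in [set: {classic I}]) phi i (dsum_val c i).

Lemma dsum_liftE (c : dsum) (X : {fset {classic I}}) :
  (forall i : {classic I}, i \notin X -> dsum_val c i = 0) ->
  dsum_lift c = \sum_(i <- X) phi i (dsum_val c i).
Proof. by move=> cX; apply: fsbigTE => i /cX ->; rewrite raddf0. Qed.

Lemma dsum_lift_is_zmod_morphism : zmod_morphism dsum_lift.
Proof.
move=> c c'; have [X cX] := dsum_supp c; have [Y cY] := dsum_supp c'.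
have XYX : forall i : {classic I}, i \notin (X `|` Y)%fset -> dsum_val c i = 0.
  by move=> i; rewrite in_fsetU negb_or => /andP[/cX].
have XYY : forall i : {classic I}, i \notin (X `|` Y)%fset -> dsum_val c' i = 0.
  by move=> i; rewrite in_fsetU negb_or => /andP[_ /cY].
rewrite (dsum_liftE XYX) (dsum_liftE XYY) (dsum_liftE (X := (X `|` Y)%fset)).
  by rewrite -sumrB; apply: eq_bigr => i _; rewrite -raddfB.
move=> i iXY; have -> : dsum_val (c - c') i = dsum_val c i - dsum_val c' i by [].
by rewrite XYX // XYY // subr0.
Qed.

HB.instance Definition _ := GRing.isZmodMorphism.Build dsum B
  dsum_lift dsum_lift_is_zmod_morphism.

Lemma dsum_lift_inj (i : I) (a : A i) : dsum_lift (dsum_inj a) = phi i a.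
Proof.
rewrite (dsum_liftE (X := [fset (i : {classic I})]%fset)) ?big_seq_fset1 ?dsum_injE //.
move=> j; rewrite inE => /eqP ji; apply: dsum_injE_neq => ij; exact: ji.
Qed.

End Lift.

Lemma dsum_ext (B : zmodType) (f g : {additive dsum -> B}) :
  (forall i (a : A i), f (dsum_inj a) = g (dsum_inj a)) -> f =1 g.
Proof.
move=> fg c; have [X cX] := dsum_supp c; rewrite (dsum_decomp cX) !raddf_sum.
by apply: eq_bigr => i _; exact: fg.
Qed.

End DirectSum.

Section QuotientLift.
Variables (V : zmodType) (S : zmodClosed V) (B : zmodType).

(* The proof argument makes the additive structure below inferable.           *)
Definition quot_lift (f : {additive V -> B})
    (f_ker : forall x, x \in S -> f x = 0) (q : Quotient.quot S) : B :=
  f (repr q).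

Variable f : {additive V -> B}.
Hypothesis f_ker : forall x, x \in S -> f x = 0.

Lemma quot_liftE (x : V) : quot_lift f_ker (\pi_(Quotient.quot S)%qT x) = f x.
Proof.
apply/eqP; rewrite -subr_eq0 -raddfB f_ker // Quotient.idealrBE.
by rewrite reprK.
Qed.

Lemma quot_lift_is_zmod_morphism : zmod_morphism (quot_lift f_ker).
Proof.
move=> x y; rewrite -[x]reprK -[y]reprK -raddfB !quot_liftE.
exact: raddfB.
Qed.

HB.instance Definition _ := GRing.isZmodMorphism.Build (Quotient.quot S) B
  (quot_lift f_ker) quot_lift_is_zmod_morphism.

End QuotientLift.

(* [fib M y] is the group M_y and, for a 1-cell x : x0 -> x1, [pull M x] is   *)
(* x^* : M_x1 -> M_x0.  As Ab has only unit 2-cells, an oo-functor to Ab      *)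
(* identifies 1-cells connected by a 2-cell.                                  *)
Record local_system (X : oocat) : Type := LocalSystem {
  fib : cell X 0 -> zmodType;
  pull : forall (x : cell X 1) (x0 x1 : cell X 0),
    s0 x = x0 -> t0 x = x1 -> {additive fib x1 -> fib x0};
  pull_unit : forall (y : cell X 0) hs ht m,
    @pull (iunit (leq0n 1) y) y y hs ht m = m;
  pull_comp : forall (h : (0 < 1)%N) (x1 x0 : cell X 1) e (y0 y1 y2 : cell X 0)
      hs ht hs0 ht0 hs1 ht1 m,
    @pull (comp h x1 x0 e) y0 y2 hs ht m =
    @pull x0 y0 y1 hs0 ht0 (@pull x1 y1 y2 hs1 ht1 m);
  pull_two_cell : forall (x x' : cell X 1) (y0 y1 : cell X 0) hs ht hs' ht' m,
    two_cell x x' -> @pull x y0 y1 hs ht m = @pull x' y0 y1 hs' ht' m;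
  pull_bij : forall (x : cell X 1) (y0 y1 : cell X 0) hs ht,
    bijective (@pull x y0 y1 hs ht)
}.
Arguments fib {X} M y : rename.
Arguments pull {X} M x [x0 x1] hs ht : rename.

Section InverseImage.
Variables (X' X : oocat) (f : oofunctor X' X) (M : local_system X).

Lemma inv_fib_src (x : cell X' 1) (x0 : cell X' 0) :
  s0 x = x0 -> s0 (f 1 x) = f 0 x0.
Proof. by move=> <-; rewrite fmap_s0. Qed.

Lemma inv_fib_tgt (x : cell X' 1) (x1 : cell X' 0) :
  t0 x = x1 -> t0 (f 1 x) = f 0 x1.
Proof. by move=> <-; rewrite fmap_t0. Qed.

Let ifib (y : cell X' 0) : zmodType := fib M (f 0 y).

Let ipull (x : cell X' 1) (x0 x1 : cell X' 0) (hs : s0 x = x0) (ht : t0 x = x1) :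
  {additive ifib x1 -> ifib x0} := pull M (f 1 x) (inv_fib_src hs) (inv_fib_tgt ht).

Definition inverse_image : local_system X'.
Proof.
refine (@LocalSystem X' ifib ipull _ _ _ _).
- move=> y hs ht m; rewrite /ipull.
  move: (inv_fib_src hs) (inv_fib_tgt ht); rewrite fmap_unit => *.
  exact: pull_unit.
- move=> h x1 x0 e y0 y1 y2 hs ht hs0 ht0 hs1 ht1 m; rewrite /ipull.
  have e' : tgt (ltnW h) (f 1 x0) = src (ltnW h) (f 1 x1).
    by rewrite -fmap_tgt -fmap_src e.
  move: (inv_fib_src hs) (inv_fib_tgt ht); rewrite (fmap_comp f e e') => *.
  exact: pull_comp.
- move=> x x' y0 y1 hs ht hs' ht' m [a [ax ax']]; apply: pull_two_cell.
  by exists (f 2 a); rewrite -ax -ax' fmap_src fmap_tgt.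
- by move=> x y0 y1 hs ht; exact: pull_bij.
Defined.

End InverseImage.

Record chain_complex : Type := ChainComplex {
  chain :> nat -> zmodType;
  diff : forall n : nat, {additive chain n.+1 -> chain n};
  diffK : forall (n : nat) (c : chain n.+2), diff n (diff n.+1 c) = 0
}.
Arguments diff C n : rename.

Record chain_map (C D : chain_complex) : Type := ChainMap {
  chain_fun :> forall n : nat, {additive C n -> D n};
  chain_mapP : forall (n : nat) (c : C n.+1),
    chain_fun n (diff C n c) = diff D n (chain_fun n.+1 c)
}.

Section Homology.
Variables (C : chain_complex) (n : nat).

Definition cycle_pred : {pred C n} :=
  match n return {pred C n} with
  | 0 => fun _ => true
  | k.+1 => fun c => diff C k c == 0
  end.

Lemma cycle_pred_closed : zmod_closed cycle_pred.
Proof.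
rewrite /cycle_pred; case: n => [|k]; first by split.
by split=> [|c c']; rewrite !unfold_in ?raddf0 // => /eqP c0 /eqP c'0;
  rewrite raddfB c0 c'0 subrr.
Qed.

HB.instance Definition _ :=
  GRing.isZmodClosed.Build (C n) cycle_pred cycle_pred_closed.

Record cycles : Type := Cycle { cycle_val : C n; _ : cycle_val \in cycle_pred }.

HB.instance Definition _ := [isSub for cycle_val].
HB.instance Definition _ := [Choice of cycles by <:].
HB.instance Definition _ := [SubChoice_isSubZmodule of cycles by <:].

Definition boundary_pred : {pred cycles} :=
  fun z => `[< exists c : C n.+1, cycle_val z = diff C n c >].

Lemma boundary_pred_closed : zmod_closed boundary_pred.
Proof.
split.
  by apply/asboolP; exists 0; rewrite raddf0.
move=> z z' /asboolP[c zc] /asboolP[c' zc']; apply/asboolP.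
by exists (c - c'); rewrite raddfB -zc -zc'.
Qed.

HB.instance Definition _ :=
  GRing.isZmodClosed.Build cycles boundary_pred boundary_pred_closed.

Definition homology : zmodType := Quotient.quot boundary_pred.

End Homology.
Arguments cycle_pred C n _ : clear implicits.
Arguments boundary_pred C n _ : clear implicits.

Section HomologyMap.
Variables (C D : chain_complex) (f : chain_map C D) (n : nat).

Lemma cycle_map_subproof (z : cycles C n) :
  f n (cycle_val z) \in cycle_pred D n.
Proof.
case: z => c /=; rewrite /cycle_pred; move: c; case: n => [|k] c //.
by rewrite !unfold_in -chain_mapP => /eqP ->; rewrite raddf0.
Qed.

Definition cycle_map (z : cycles C n) : cycles D n :=
  Cycle (cycle_map_subproof z).

Lemma cycle_map_is_zmod_morphism : zmod_morphism cycle_map.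
Proof. by move=> z z'; apply: val_inj; rewrite /= raddfB. Qed.

HB.instance Definition _ := GRing.isZmodMorphism.Build (cycles C n) (cycles D n)
  cycle_map cycle_map_is_zmod_morphism.

Let to_homology (z : cycles C n) : homology D n :=
  (\pi_(Quotient.quot (boundary_pred D n))%qT (cycle_map z)).

Lemma to_homology_is_zmod_morphism : zmod_morphism to_homology.
Proof. by move=> z z'; rewrite /to_homology raddfB raddfB. Qed.

HB.instance Definition _ := GRing.isZmodMorphism.Build (cycles C n) (homology D n)
  to_homology to_homology_is_zmod_morphism.

Lemma to_homology_boundary (z : cycles C n) :
  z \in boundary_pred C n -> to_homology z = 0.
Proof.
move=> /asboolP[c zc]; rewrite /to_homology.
have <- : (\pi_(Quotient.quot (boundary_pred D n))%qT 0) = 0 by rewrite raddf0.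
apply/eqP; rewrite -Quotient.idealrBE subr0.
by apply/asboolP; exists (f n.+1 c); rewrite /= zc chain_mapP.
Qed.

Definition homology_map : {additive homology C n -> homology D n} :=
  quot_lift to_homology_boundary.

End HomologyMap.

Section ChainsOfOocat.
Variables (X : oocat) (M : local_system X).

Lemma pull_eq (x x' : cell X 1) (y0 y1 : cell X 0) hs ht hs' ht' m :
  x = x' -> pull M x (x0 := y0) (x1 := y1) hs ht m = pull M x' hs' ht' m.
Proof.
by move=> xx'; subst x'; rewrite (Prop_irrelevance hs hs') (Prop_irrelevance ht ht').
Qed.

Definition chain_sum (n : nat) : Type := dsum (fun x : cell X n => fib M (t0 x)).
HB.instance Definition _ n := GRing.Zmodule.on (chain_sum n).

(* The element (x, m) of the sum.  The group containing m is indexed by an    *)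
(* object y equal to t0 x, which avoids transports everywhere else.           *)
Definition gen (n : nat) (x : cell X n) (y : cell X 0) (e : t0 x = y)
    (m : fib M y) : chain_sum n :=
  dsum_inj (A := fun x : cell X n => fib M (t0 x)) (i := x)
    (ecast z (fib M z) (esym e) m).
Arguments gen [n] x [y] e m.

Lemma gen_is_zmod_morphism n (x : cell X n) (y : cell X 0) (e : t0 x = y) :
  zmod_morphism (gen x e).
Proof. by subst y => m m'; rewrite /gen /= raddfB. Qed.

Inductive chain_equiv (n : nat) : chain_sum n -> chain_sum n -> Prop :=
| ceq_comp0 (h : (0 < n)%N) (x1 x0 : cell X n) e (y0 y1 : cell X 0)
    (et : t0 (comp h x1 x0 e) = y1) (et1 : t0 x1 = y1) (et0 : t0 x0 = y0)
    (hs : s0 (tgt h x1) = y0) (ht : t0 (tgt h x1) = y1) (m : fib M y1) :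
    chain_equiv (gen (comp h x1 x0 e) et m)
                (gen x1 et1 m + gen x0 et0 (pull M (tgt h x1) hs ht m))
| ceq_comp (i : nat) (i_gt0 : (0 < i)%N) (h : (i < n)%N) (x1 x0 : cell X n) e
    (y : cell X 0) (et : t0 (comp h x1 x0 e) = y) (et1 : t0 x1 = y)
    (et0 : t0 x0 = y) (m : fib M y) :
    chain_equiv (gen (comp h x1 x0 e) et m) (gen x1 et1 m + gen x0 et0 m)
| ceq_refl c : chain_equiv c c
| ceq_sym c c' : chain_equiv c c' -> chain_equiv c' c
| ceq_trans c c' c'' : chain_equiv c c' -> chain_equiv c' c'' -> chain_equiv c c''
| ceq_add c c' b b' :
    chain_equiv c c' -> chain_equiv b b' -> chain_equiv (c + b) (c' + b').

Definition chain_null (n : nat) : {pred chain_sum n} :=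
  fun c => `[< chain_equiv c 0 >].
Arguments chain_null n _ : clear implicits.

Lemma chain_null_closed n : zmod_closed (chain_null n).
Proof.
split; first by apply/asboolP; exact: ceq_refl.
move=> c c' /asboolP c0 /asboolP c'0; apply/asboolP.
apply: ceq_trans (ceq_add c0 (ceq_refl (- c'))) _.
by have := ceq_add (ceq_sym c'0) (ceq_refl (- c')); rewrite subrr.
Qed.

HB.instance Definition _ n := GRing.isZmodClosed.Build (chain_sum n)
  (chain_null n) (chain_null_closed n).

(* As ~_n is compatible with addition, the quotient by ~_n is the quotient by *)
(* the subgroup of the elements equivalent to 0.                              *)
Definition chain_group (n : nat) : zmodType := Quotient.quot (chain_null n).

Definition chain_class (n : nat) (c : chain_sum n) : chain_group n :=
  \pi_(Quotient.quot (chain_null n))%qT c.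

Lemma chain_class_is_zmod_morphism n : zmod_morphism (@chain_class n).
Proof. by move=> c c'; rewrite /chain_class raddfB. Qed.

HB.instance Definition _ n := GRing.isZmodMorphism.Build (chain_sum n)
  (chain_group n) (@chain_class n) (@chain_class_is_zmod_morphism n).

Lemma chain_classP n (c c' : chain_sum n) :
  chain_class c = chain_class c' <-> chain_equiv c c'.
Proof.
rewrite (rwP eqP) -Quotient.idealrBE -(rwP (asboolP _)); split=> cc'.
  by have := ceq_add cc' (ceq_refl c'); rewrite subrK add0r.
by have := ceq_add cc' (ceq_refl (- c')); rewrite subrr.
Qed.

Definition cls (n : nat) (x : cell X n) (y : cell X 0) (e : t0 x = y)
  (m : fib M y) : chain_group n := chain_class (gen x e m).
Arguments cls [n] x [y] e m.

Lemma cls_is_zmod_morphism n (x : cell X n) (y : cell X 0) (e : t0 x = y) :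
  zmod_morphism (cls x e).
Proof. by move=> m m'; rewrite /cls gen_is_zmod_morphism raddfB. Qed.

HB.instance Definition _ n (x : cell X n) (y : cell X 0) (e : t0 x = y) :=
  GRing.isZmodMorphism.Build (fib M y) (chain_group n) (cls x e)
    (cls_is_zmod_morphism e).

Lemma cls_eq n (x x' : cell X n) (y : cell X 0) (e : t0 x = y) (e' : t0 x' = y) m :
  x = x' -> cls x e m = cls x' e' m.
Proof. by move=> xx'; subst x'; rewrite (Prop_irrelevance e e'). Qed.

Lemma cls_comp0 n (h : (0 < n)%N) (x1 x0 : cell X n) e (y0 y1 : cell X 0)
    (et : t0 (comp h x1 x0 e) = y1) (et1 : t0 x1 = y1) (et0 : t0 x0 = y0)
    (hs : s0 (tgt h x1) = y0) (ht : t0 (tgt h x1) = y1) (m : fib M y1) :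
  cls (comp h x1 x0 e) et m =
  cls x1 et1 m + cls x0 et0 (pull M (tgt h x1) hs ht m).
Proof. by rewrite /cls -raddfD; apply/chain_classP; exact: ceq_comp0. Qed.

Lemma cls_comp n (i : nat) (i_gt0 : (0 < i)%N) (h : (i < n)%N)
    (x1 x0 : cell X n) e (y : cell X 0) (et : t0 (comp h x1 x0 e) = y)
    (et1 : t0 x1 = y) (et0 : t0 x0 = y) (m : fib M y) :
  cls (comp h x1 x0 e) et m = cls x1 et1 m + cls x0 et0 m.
Proof. by rewrite /cls -raddfD; apply/chain_classP; exact: ceq_comp. Qed.

Lemma chain_ext n (B : zmodType) (f g : {additive chain_group n -> B}) :
  (forall (x : cell X n) (y : cell X 0) (e : t0 x = y) m,
     f (cls x e m) = g (cls x e m)) -> f =1 g.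
Proof.
move=> fg c; rewrite -[c]reprK.
apply: (dsum_ext (f := f \o @chain_class n) (g := g \o @chain_class n)) => x m.
exact: (fg x _ erefl).
Qed.

Section ChainLift.
Variables (n : nat) (B : zmodType).
Variable phi : forall x : cell X n, {additive fib M (t0 x) -> B}.

Definition chain_sum_lift : {additive chain_sum n -> B} := dsum_lift phi.

Definition chain_compatible : Prop :=
  forall c c' : chain_sum n, chain_equiv c c' ->
  chain_sum_lift c = chain_sum_lift c'.

Hypothesis phiP : chain_compatible.

Lemma chain_lift_subproof (c : chain_sum n) :
  c \in chain_null n -> chain_sum_lift c = 0.
Proof. by move=> /asboolP /phiP ->; rewrite raddf0. Qed.

Definition chain_lift : {additive chain_group n -> B} :=
  quot_lift chain_lift_subproof.

Lemma chain_sum_lift_gen (x : cell X n) (y : cell X 0) (e : t0 x = y) m :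
  chain_sum_lift (gen x e m) = phi x (ecast z (fib M z) (esym e) m).
Proof. exact: dsum_lift_inj. Qed.

Lemma chain_lift_cls (x : cell X n) (y : cell X 0) (e : t0 x = y) m :
  chain_lift (cls x e m) = phi x (ecast z (fib M z) (esym e) m).
Proof.
by rewrite -chain_sum_lift_gen; exact: (quot_liftE chain_lift_subproof).
Qed.

End ChainLift.

Lemma t0_id (y : cell X 0) : t0 y = y. Proof. exact: tgt_id. Qed.

Lemma s0_id (y : cell X 0) : s0 y = y. Proof. exact: src_id. Qed.

Lemma t0_tgt i n (h : (i <= n)%N) (x : cell X n) : t0 (tgt h x) = t0 x.
Proof. exact: tgt_tgt. Qed.

Lemma t0_src i n (h : (i <= n)%N) (x : cell X n) :
  (0 < i)%N -> t0 (src h x) = t0 x.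
Proof.
by move=> i0; rewrite /t0 (bool_irrelevance (leq0n i) (ltnW i0)); exact: tgt_src.
Qed.

Definition bound (n : nat) : forall x : cell X n.+1, fib M (t0 x) -> chain_group n :=
  match n with
  | 0 => fun x m =>
      cls (t0 x) (t0_id (t0 x)) m
      - cls (s0 x) (t0_id (s0 x)) (pull M x erefl erefl m)
  | k.+1 => fun x m =>
      cls (tgt (leqnSn k.+1) x) (t0_tgt (leqnSn k.+1) x) m
      - cls (src (leqnSn k.+1) x) (t0_src (leqnSn k.+1) x (ltn0Sn k)) m
  end.

Lemma bound_is_zmod_morphism n (x : cell X n.+1) : zmod_morphism (@bound n x).
Proof.
by case: n x => [|n] x m m' /=; rewrite !raddfB /= addrACA.
Qed.

HB.instance Definition _ n (x : cell X n.+1) :=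
  GRing.isZmodMorphism.Build (fib M (t0 x)) (chain_group n) (@bound n x)
    (@bound_is_zmod_morphism n x).

Lemma bound0_cast (x : cell X 1) (y0 y1 : cell X 0) (e : t0 x = y1)
    (e1 : t0 (t0 x) = y1) (e0 : t0 (s0 x) = y0) (hs : s0 x = y0) (m : fib M y1) :
  @bound 0 x (ecast z (fib M z) (esym e) m) =
  cls (t0 x) e1 m - cls (s0 x) e0 (pull M x hs e m).
Proof.
move: e1 e0 m; case: y1 / e => e1; case: y0 / hs => e0 m /=.
congr (_ - _); first exact: cls_eq.
exact: cls_eq.
Qed.

Lemma boundS_cast n (x : cell X n.+2) (y : cell X 0) (e : t0 x = y) et es m :
  @bound n.+1 x (ecast z (fib M z) (esym e) m) =
  cls (tgt (leqnSn n.+1) x) (y := y) et m - cls (src (leqnSn n.+1) x) es m.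
Proof. by subst y => /=; congr (_ - _); exact: cls_eq. Qed.

Arguments bound n x m : simpl never.

Let bound_lift n : {additive chain_sum n.+1 -> chain_group n} :=
  chain_sum_lift (@bound n).

Lemma bound_lift0 (x : cell X 1) (y0 y1 : cell X 0) (e : t0 x = y1)
    (e1 : t0 (t0 x) = y1) (e0 : t0 (s0 x) = y0) (hs : s0 x = y0) (m : fib M y1) :
  bound_lift 0 (gen x e m) = cls (t0 x) e1 m - cls (s0 x) e0 (pull M x hs e m).
Proof. by rewrite /bound_lift chain_sum_lift_gen; exact: bound0_cast. Qed.

Lemma bound_liftS n (x : cell X n.+2) (y : cell X 0) (e : t0 x = y) et es m :
  bound_lift n.+1 (gen x e m) =
  cls (tgt (leqnSn n.+1) x) (y := y) et m - cls (src (leqnSn n.+1) x) es m.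
Proof. by rewrite /bound_lift chain_sum_lift_gen; exact: boundS_cast. Qed.

Lemma pull_src n (x : cell X n.+2) (h : (0 < n.+2)%N) (h' : (0 < n.+1)%N)
    (y0 y1 : cell X 0) hs ht hs' ht' m :
  pull M (tgt h' (src (leqnSn n.+1) x)) (x0 := y0) (x1 := y1) hs' ht' m =
  pull M (tgt h x) hs ht m.
Proof.
case: n x h h' hs ht hs' ht' => [|n] x h h' hs ht hs' ht'.
  apply: pull_two_cell; exists x; rewrite tgt_id.
  by rewrite (bool_irrelevance (leqnSn 1) isT) (bool_irrelevance h isT).
apply: pull_eq; rewrite (bool_irrelevance h' (ltnW (isT : (1 < n.+2)%N))).
exact: tgt_src.
Qed.

Lemma pull_tgt n (x : cell X n.+2) (h : (0 < n.+2)%N) (h' : (0 < n.+1)%N)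
    (y0 y1 : cell X 0) hs ht hs' ht' m :
  pull M (tgt h' (tgt (leqnSn n.+1) x)) (x0 := y0) (x1 := y1) hs' ht' m =
  pull M (tgt h x) hs ht m.
Proof. by apply: pull_eq; exact: tgt_tgt. Qed.

Lemma bound_compatible n : chain_compatible (@bound n).
Proof.
rewrite /chain_compatible -/(bound_lift n) => c c'; elim=> {c c'}; last first.
- by move=> c c' b b' _ IHc _ IHb; rewrite !raddfD /= IHc IHb.
- by move=> c c' c'' _ -> _ ->.
- by move=> c c' _ ->.
- by [].
- move=> i i0 h x1 x0 e y et et1 et0 m; rewrite raddfD.
  case: n x1 x0 h e et et1 et0 => [|n] x1 x0 h e et et1 et0.
    by exfalso; move: (h); rewrite ltnS leqNgt i0.
  have tgtE (x : cell X n.+2) : t0 x = y -> t0 (tgt (leqnSn n.+1) x) = y.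
    by rewrite t0_tgt.
  have srcE (x : cell X n.+2) : t0 x = y -> t0 (src (leqnSn n.+1) x) = y.
    by rewrite t0_src.
  rewrite (bound_liftS et (tgtE _ et) (srcE _ et)).
  rewrite (bound_liftS et1 (tgtE _ et1) (srcE _ et1)).
  rewrite (bound_liftS et0 (tgtE _ et0) (srcE _ et0)).
  have /orP[/eqP ei|hi] : (i == n.+1) || (i < n.+1)%N by rewrite -leq_eqVlt -ltnS.
    subst i; have hE : leqnSn n.+1 = ltnW h by exact: bool_irrelevance.
    have tE : tgt (leqnSn n.+1) (comp h x1 x0 e) = tgt (leqnSn n.+1) x1.
      by rewrite hE tgt_comp.
    have sE : src (leqnSn n.+1) (comp h x1 x0 e) = src (leqnSn n.+1) x0.
      by rewrite hE src_comp.
    have mE : tgt (leqnSn n.+1) x0 = src (leqnSn n.+1) x1 by rewrite hE e.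
    rewrite (cls_eq _ (tgtE _ et1) _ tE) (cls_eq _ (srcE _ et0) _ sE).
    by rewrite (cls_eq _ (srcE _ et1) _ mE) addrA subrK.
  have eT : tgt (ltnW hi) (tgt (leqnSn n.+1) x0) =
            src (ltnW hi) (tgt (leqnSn n.+1) x1).
    by rewrite (tgt_tgt _ _ (ltnW h)) (src_tgt _ _ (ltnW h)) e.
  have eS : tgt (ltnW hi) (src (leqnSn n.+1) x0) =
            src (ltnW hi) (src (leqnSn n.+1) x1).
    by rewrite (tgt_src _ _ (ltnW h)) (src_src _ _ (ltnW h)) e.
  have tE := tgt_comp_gt hi (leqnSn n.+1) e eT.
  have sE := src_comp_gt hi (leqnSn n.+1) e eS.
  have tE' := tgtE _ et; rewrite tE in tE'.
  have sE' := srcE _ et; rewrite sE in sE'.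
  rewrite (cls_eq _ tE' _ tE) (cls_eq _ sE' _ sE).
  rewrite (cls_comp i0 tE' (tgtE _ et1) (tgtE _ et0) m).
  rewrite (cls_comp i0 sE' (srcE _ et1) (srcE _ et0) m).
  by rewrite opprD addrACA.
- move=> h x1 x0 e y0 y1 et et1 et0 hs ht m; rewrite raddfD.
  have eS : t0 x0 = s0 x1.
    by rewrite /t0 /s0 !(bool_irrelevance (leq0n _) (ltnW h)).
  case: n h x1 x0 e et et1 et0 hs ht eS => [|n] h x1 x0 e et et1 et0 hs ht eS.
    have hsc : s0 (comp h x1 x0 e) = s0 x0.
      by rewrite /s0 !(bool_irrelevance (leq0n _) (ltnW h)) src_comp.
    have htc : t0 (comp h x1 x0 e) = t0 x1.
      by rewrite /t0 !(bool_irrelevance (leq0n _) (ltnW h)) tgt_comp.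
    have hs1 : s0 x1 = y0 by rewrite -eS.
    have tt (x : cell X 1) y : t0 x = y -> t0 (t0 x) = y by rewrite t0_id.
    have ts (x : cell X 1) y : s0 x = y -> t0 (s0 x) = y by rewrite t0_id.
    rewrite (bound_lift0 et (tt _ _ et) (ts _ _ hsc) hsc).
    rewrite (bound_lift0 et1 (tt _ _ et1) (ts _ _ hs1) hs1).
    rewrite (bound_lift0 et0 (tt _ _ et0) (ts _ _ erefl) erefl).
    rewrite (cls_eq (tt _ _ et) (tt _ _ et1) _ htc).
    rewrite (cls_eq (ts _ _ hsc) (ts _ _ erefl) _ hsc).
    rewrite (cls_eq (tt _ _ et0) (ts _ _ hs1) _ eS).
    rewrite (pull_comp hsc et erefl et0 hs1 et1).
    rewrite (pull_eq hs ht hs1 et1 m (tgt_id h x1)).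
    by rewrite addrA subrK.
  have h' : (0 < n.+1)%N by [].
  have tgtE (x : cell X n.+2) y : t0 x = y -> t0 (tgt (leqnSn n.+1) x) = y.
    by rewrite t0_tgt.
  have srcE (x : cell X n.+2) y : t0 x = y -> t0 (src (leqnSn n.+1) x) = y.
    by rewrite t0_src.
  rewrite (bound_liftS et (tgtE _ _ et) (srcE _ _ et)).
  rewrite (bound_liftS et1 (tgtE _ _ et1) (srcE _ _ et1)).
  rewrite (bound_liftS et0 (tgtE _ _ et0) (srcE _ _ et0)).
  have eT : tgt (ltnW h') (tgt (leqnSn n.+1) x0) =
            src (ltnW h') (tgt (leqnSn n.+1) x1).
    by rewrite (tgt_tgt _ _ (ltnW h)) (src_tgt _ _ (ltnW h)) e.
  have eSr : tgt (ltnW h') (src (leqnSn n.+1) x0) =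
            src (ltnW h') (src (leqnSn n.+1) x1).
    by rewrite (tgt_src _ _ (ltnW h)) (src_src _ _ (ltnW h)) e.
  have tE := tgt_comp_gt h' (leqnSn n.+1) e eT.
  have sE := src_comp_gt h' (leqnSn n.+1) e eSr.
  have tE' := tgtE _ _ et; rewrite tE in tE'.
  have sE' := srcE _ _ et; rewrite sE in sE'.
  rewrite (cls_eq _ tE' _ tE) (cls_eq _ sE' _ sE).
  have hst : s0 (tgt h' (tgt (leqnSn n.+1) x1)) = y0 by rewrite (tgt_tgt _ _ h).
  have htt : t0 (tgt h' (tgt (leqnSn n.+1) x1)) = y1 by rewrite (tgt_tgt _ _ h).
  have hss : s0 (tgt h' (src (leqnSn n.+1) x1)) = y0.
    rewrite -et0 eS /s0 [X in src X _](bool_irrelevance (leq0n 1) (ltnW (isT : (0 < 1)%N))).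
    rewrite (src_tgt (isT : (0 < 1)%N) _ (leq0n _)).
    exact: src_src.
  have hts : t0 (tgt h' (src (leqnSn n.+1) x1)) = y1 by rewrite t0_tgt t0_src.
  rewrite (cls_comp0 tE' (tgtE _ _ et1) (tgtE _ _ et0) hst htt m).
  rewrite (cls_comp0 sE' (srcE _ _ et1) (srcE _ _ et0) hss hts m).
  rewrite (pull_tgt hs ht) (pull_src hs ht).
  by rewrite opprD addrACA.
Qed.

Definition chain_diff (n : nat) : {additive chain_group n.+1 -> chain_group n} :=
  chain_lift (@bound_compatible n).

Lemma chain_diff0 (x : cell X 1) (y0 y1 : cell X 0) (e : t0 x = y1)
    (e1 : t0 (t0 x) = y1) (e0 : t0 (s0 x) = y0) (hs : s0 x = y0) (m : fib M y1) :
  chain_diff 0 (cls x e m) = cls (t0 x) e1 m - cls (s0 x) e0 (pull M x hs e m).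
Proof. by rewrite /chain_diff chain_lift_cls; exact: bound0_cast. Qed.

Lemma chain_diffS n (x : cell X n.+2) (y : cell X 0) (e : t0 x = y) et es m :
  chain_diff n.+1 (cls x e m) =
  cls (tgt (leqnSn n.+1) x) (y := y) et m - cls (src (leqnSn n.+1) x) es m.
Proof. by rewrite /chain_diff chain_lift_cls; exact: boundS_cast. Qed.

Lemma chain_diffK (n : nat) (c : chain_group n.+2) :
  chain_diff n (chain_diff n.+1 c) = 0.
Proof.
have := @chain_ext _ _ (chain_diff n \o chain_diff n.+1) \0 _ c; apply.
move=> {c} x y e m; change (chain_diff n (chain_diff n.+1 (cls x e m)) = 0).
have tE : t0 (tgt (leqnSn n.+1) x) = y by rewrite t0_tgt.
have sE : t0 (src (leqnSn n.+1) x) = y by rewrite t0_src.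
rewrite (chain_diffS e tE sE) raddfB.
case: n x e tE sE => [|n] x e tE sE.
  have [ss st] : s0 (src (leqnSn 1) x) = s0 (tgt (leqnSn 1) x) /\
                 t0 (src (leqnSn 1) x) = t0 (tgt (leqnSn 1) x).
    by apply: two_cell_ends; exists x; rewrite (bool_irrelevance (leqnSn 1) isT).
  have tt : t0 (t0 (tgt (leqnSn 1) x)) = y by rewrite t0_id.
  have ts : t0 (t0 (src (leqnSn 1) x)) = y by rewrite t0_id.
  rewrite (chain_diff0 tE tt (t0_id _) erefl).
  have e0 := etrans (t0_id (s0 (src (leqnSn 1) x))) ss.
  rewrite (chain_diff0 sE ts e0 ss).
  rewrite (cls_eq ts tt m st).
  have E : pull M (src (leqnSn 1) x) ss sE m = pull M (tgt (leqnSn 1) x) erefl tE m.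
    apply: pull_two_cell; exists x.
    by rewrite (bool_irrelevance (leqnSn 1) isT).
  by rewrite E (cls_eq e0 (t0_id _) _ ss) subrr.
have ttE z : t0 z = y -> t0 (tgt (leqnSn n.+1) z) = y by rewrite t0_tgt.
have tsE z : t0 z = y -> t0 (src (leqnSn n.+1) z) = y by rewrite t0_src.
rewrite (chain_diffS tE (ttE _ tE) (tsE _ tE)).
rewrite (chain_diffS sE (ttE _ sE) (tsE _ sE)).
have tt : tgt (leqnSn n.+1) (tgt (leqnSn n.+2) x) =
          tgt (leqnSn n.+1) (src (leqnSn n.+2) x).
  rewrite (bool_irrelevance (leqnSn n.+1) (ltnW (ltnSn n.+1))).
  rewrite (tgt_src _ _ (ltnW (ltnW (ltnSn n.+2)))).
  exact: tgt_tgt.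
have ss : src (leqnSn n.+1) (tgt (leqnSn n.+2) x) =
          src (leqnSn n.+1) (src (leqnSn n.+2) x).
  rewrite (bool_irrelevance (leqnSn n.+1) (ltnW (ltnSn n.+1))).
  rewrite (src_tgt _ _ (ltnW (ltnW (ltnSn n.+2)))).
  by rewrite (src_src _ _ (ltnW (ltnW (ltnSn n.+2)))).
rewrite (cls_eq (ttE _ tE) (ttE _ sE) _ tt).
by rewrite (cls_eq (tsE _ tE) (tsE _ sE) _ ss) subrr.
Qed.

Definition chains : chain_complex := ChainComplex chain_diffK.

End ChainsOfOocat.

Arguments gen {X M} [n] x [y] e m.
Arguments cls {X M} [n] x [y] e m.

Section ChainsFunctor.
Variables (X' X : oocat) (f : oofunctor X' X) (M : local_system X).
Let M' : local_system X' := inverse_image f M.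

Let cmap n (x : cell X' n) : {additive fib M' (t0 x) -> chain_group M n} :=
  (cls (M := M) (f n x) (esym (fmap_t0 f x))
     : {additive fib M (f 0 (t0 x)) -> chain_group M n}).

Let cmap_gen n (x : cell X' n) (y : cell X' 0) (e : t0 x = y)
    (e' : t0 (f n x) = f 0 y) (m : fib M' y) :
  chain_sum_lift (@cmap n) (gen (M := M') x e m) = cls (M := M) (f n x) e' m.
Proof.
rewrite chain_sum_lift_gen; move: e' m; case: y / e => e' m.
exact: cls_eq.
Qed.

Lemma cmap_compatible n : chain_compatible (@cmap n).
Proof.
move=> c c'; elim=> {c c'}; last first.
- by move=> c c' b b' _ IHc _ IHb; rewrite !raddfD IHc IHb.
- by move=> c c' c'' _ -> _ ->.
- by move=> c c' _ ->.
- by [].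
- move=> i i0 h x1 x0 e y et et1 et0 m; rewrite raddfD.
  have fE (x : cell X' n) : t0 x = y -> t0 (f n x) = f 0 y by move=> <-; rewrite fmap_t0.
  rewrite (cmap_gen et (fE _ et)) (cmap_gen et1 (fE _ et1)) (cmap_gen et0 (fE _ et0)).
  have e' : tgt (ltnW h) (f n x0) = src (ltnW h) (f n x1).
    by rewrite -fmap_tgt -fmap_src e.
  have E := fmap_comp f e e'; have ft := fE _ et; rewrite E in ft.
  by rewrite (cls_eq _ ft _ E); exact: cls_comp.
- move=> h x1 x0 e y0 y1 et et1 et0 hs ht m; rewrite raddfD.
  have fE (x : cell X' n) y : t0 x = y -> t0 (f n x) = f 0 y by move=> <-; rewrite fmap_t0.
  rewrite (cmap_gen et (fE _ _ et)) (cmap_gen et1 (fE _ _ et1)) (cmap_gen et0 (fE _ _ et0)).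
  have e' : tgt (ltnW h) (f n x0) = src (ltnW h) (f n x1).
    by rewrite -fmap_tgt -fmap_src e.
  have E := fmap_comp f e e'; have ft := fE _ _ et; rewrite E in ft.
  have hs' : s0 (tgt h (f n x1)) = f 0 y0 by rewrite -fmap_tgt -fmap_s0 hs.
  have ht' : t0 (tgt h (f n x1)) = f 0 y1 by rewrite -fmap_tgt -fmap_t0 ht.
  rewrite (cls_eq _ ft _ E) (cls_comp0 ft (fE _ _ et1) (fE _ _ et0) hs' ht').
  congr (_ + cls _ _ _); apply: pull_eq; by rewrite fmap_tgt.
Qed.

Definition chains_map_fun (n : nat) : {additive chain_group M' n -> chain_group M n} :=
  chain_lift (@cmap_compatible n).

Lemma chains_map_cls n (x : cell X' n) (y : cell X' 0) (e : t0 x = y)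
    (e' : t0 (f n x) = f 0 y) (m : fib M' y) :
  chains_map_fun n (cls (M := M') x e m) = cls (M := M) (f n x) e' m.
Proof.
rewrite /chains_map_fun chain_lift_cls; move: e' m; case: y / e => e' m.
exact: cls_eq.
Qed.

Lemma chains_mapP (n : nat) (c : chain_group M' n.+1) :
  chains_map_fun n (chain_diff M' n c) = chain_diff M n (chains_map_fun n.+1 c).
Proof.
have := @chain_ext _ _ _ _ (chains_map_fun n \o chain_diff M' n)
  (chain_diff M n \o chains_map_fun n.+1) _ c; apply.
move=> {c} x y e m.
change (chains_map_fun n (chain_diff M' n (cls (M := M') x e m)) =
        chain_diff M n (chains_map_fun n.+1 (cls (M := M') x e m))).
have fE k (z : cell X' k) w : t0 z = w -> t0 (f k z) = f 0 w by move=> <-; rewrite fmap_t0.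
rewrite (chains_map_cls e (fE _ _ _ e)).
case: n x e => [|n] x e.
  have e1 : t0 (t0 x) = y by rewrite t0_id.
  have e0 : t0 (s0 x) = s0 x by exact: t0_id.
  have fe1 : t0 (t0 (f 1 x)) = f 0 y by rewrite t0_id; exact: fE.
  have fe0 : t0 (s0 (f 1 x)) = f 0 (s0 x) by rewrite t0_id fmap_s0.
  rewrite (chain_diff0 (M := M') e e1 e0 erefl) raddfB.
  rewrite (chain_diff0 (M := M) (fE _ _ _ e) fe1 fe0 (esym (fmap_s0 f x))).
  rewrite (chains_map_cls e1 (fE _ _ _ e1)) (chains_map_cls e0 (fE _ _ _ e0)).
  congr (_ - _); first by apply: cls_eq; exact: fmap_t0.
  rewrite (cls_eq _ fe0 _ (fmap_s0 f x)); congr (cls _ _ _).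
  exact: pull_eq.
have et : t0 (tgt (leqnSn n.+1) x) = y by rewrite t0_tgt.
have es : t0 (src (leqnSn n.+1) x) = y by rewrite t0_src.
have fet : t0 (tgt (leqnSn n.+1) (f n.+2 x)) = f 0 y by rewrite t0_tgt; exact: fE.
have fes : t0 (src (leqnSn n.+1) (f n.+2 x)) = f 0 y by rewrite t0_src //; exact: fE.
rewrite (chain_diffS (M := M') e et es) (chain_diffS (M := M) (fE _ _ _ e) fet fes).
rewrite raddfB (chains_map_cls et (fE _ _ _ et)) (chains_map_cls es (fE _ _ _ es)).
congr (_ - _); apply: cls_eq; [exact: fmap_tgt|exact: fmap_src].
Qed.

Definition chains_map : chain_map (chains M') (chains M) :=
  @ChainMap (chains M') (chains M) chains_map_fun chains_mapP.

End ChainsFunctor.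

Local Close Scope ring_scope.

(* H^pol_n(f, M) is an isomorphism.  It is computed by means of polygraphic   *)
(* resolutions p' and p of X' and X and of a lift ft : P' -> P of f; as       *)
(* p \o ft = f \o p', the source of the map below is the homology of P' with  *)
(* coefficients in ft^* p^* M = p'^* f^* M.  Homology does not depend on      *)
(* these choices up to canonical isomorphism, so all of them are considered.  *)
Definition polygraphic_homology_iso (X' X : oocat) (f : oofunctor X' X)
    (M : local_system X) (n : nat) : Prop :=
  forall (P' P : oocat) (p' : oofunctor P' X') (p : oofunctor P X)
    (ft : oofunctor P' P),
    polygraphic_resolution p' -> polygraphic_resolution p ->
    oofunctor_eq (oocomp p ft) (oocomp f p') ->
    bijective (homology_map (chains_map ft (inverse_image p M)) n).

Definition polygraphic_equivalence (X' X : oocat) (f : oofunctor X' X) : Prop :=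
  is_equivalence (Pi1_functor f) /\
  forall (M : local_system X) (n : nat), polygraphic_homology_iso f M n.

(* Main.v *)
From HB Require Import structures.
From Stdlib Require Import Relation_Operators RelationClasses.
From mathcomp Require Import all_boot all_algebra.
From mathcomp Require Import boolp.
Require Import Defs.

Set Implicit Arguments.
Unset Strict Implicit.
Unset Printing Implicit Defensive.

Import GRing.Theory.

Local Open Scope nat_scope.

(** The statement splits into one about fundamental groupoids and one about
    polygraphic homology.  The first is the 2-out-of-3 property of
    equivalences of categories, since [Pi1_functor] is functorial up to a
    natural isomorphism ([Pi1_functor_comp]).

    For homology, once resolutions P'' -> X'', P' -> X', P -> X and lifts
    gt : P'' -> P' and ft : P' -> P of g and f are fixed, the map induced by
    ft \o gt is the composite of those induced by gt and ft, and bijections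
    have the 2-out-of-3 property.  Since the isomorphism condition is asked
    for every choice of resolutions and lifts, one is free to choose the
    missing data so that such a strictly commutative situation arises, and
    lifts never have to be compared up to homotopy:
    - to reach g or f, the missing resolution exists
      ([polygraphic_polygraphic_resolution_exists]), the missing lift exists because
      polygraphs are cofibrant, and the lift of the composite f \o g is taken
      to be the composite of the lifts;
    - to reach f \o g, an arbitrary lift ht : P'' -> P of it is given, and P'
      has to be found so that ht factors through it over X'.  Factor the
      induced map P'' -> X' x_X P into a cofibration P'' -> P' followed by a
      trivial fibration; as X' x_X P -> X' is a trivial fibration too, P' is a
      resolution of X'.

    Both constructions rest on the factorization of any oo-functor A -> W as a
    cofibration followed by a trivial fibration
    ([cofibration_trivial_fibration_factorization]).  The middle object is the
    initial algebra for chosen liftings: the initial oo-category under A and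
    over W equipped with a choice of a filler for each lifting problem against
    the inclusions of spheres into disks.  It is cofibrant under A because the
    pullback of a trivial fibration along a map out of it can again be given
    chosen fillers, compatibly with the projection, so that initiality yields
    a section.

    Finally, when the conclusion is about g, coefficients range over the local
    systems on X', whereas the hypotheses only speak of those pulled back from
    X.  As [Pi1_functor f] is an equivalence, every local system on X' is
    isomorphic to such a pullback ([inverse_image_ess_surj]), and isomorphic
    coefficients give isomorphic homology. *)

(** * Joint embeddings of oo-categories *)

Lemma oofunctor_ext (X Y : oocat) (F G : oofunctor X Y) :
  oofunctor_eq F G -> F = G.
Proof.
case: F G => [F Fs Ft Fu Fc] [G Gs Gt Gu Gc] /= FG.
have E : F = G by do 2!apply: functional_extensionality_dep => ?; exact: FG.
case: G / E Gs Gt Gu Gc {FG} => Gs Gt Gu Gc.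
by congr OoFunctor; exact: Prop_irrelevance.
Qed.

Definition oofunctor_id (X : oocat) : oofunctor X X.
Proof.
by refine (@OoFunctor X X (fun _ x => x) _ _ _ _) => * //; exact: comp_irr.
Defined.

(** The composite made into a total operation, so that terms can be evaluated
    by plain recursion; the value on non-composable cells is arbitrary. *)
Definition comp_or_left (X : oocat) i n (h : i < n) (x1 x0 : cell X n) : cell X n :=
  if pselect (tgt (ltnW h) x0 = src (ltnW h) x1) is left e then comp h x1 x0 e
  else x1.

Lemma comp_or_leftE (X : oocat) i n (h : i < n) (x1 x0 : cell X n) e :
  comp_or_left h x1 x0 = comp h x1 x0 e.
Proof. by rewrite /comp_or_left; case: pselect => // e'; exact: comp_irr. Qed.

(** A graded set whose elements are determined by their values in a family of
    oo-categories, and on which the operations are defined compatibly with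
    these values, is an oo-category: each law is an equality that can be
    tested in every member of the family.  Pullbacks and initial algebras are
    both obtained in this way, as they embed in a product. *)
Section Jointly.
Variables (I : Type) (Y : I -> oocat) (C : nat -> Type).
Variable ev : forall (i : I) n, C n -> cell (Y i) n.
Hypothesis ev_inj : forall n (x y : C n), (forall i, ev i x = ev i y) -> x = y.
Variables (csrc ctgt : forall k n, k <= n -> C n -> C k).
Variable cunit : forall k n, k <= n -> C k -> C n.
Variable ccomp : forall k n (h : k < n) (x1 x0 : C n),
  ctgt (ltnW h) x0 = csrc (ltnW h) x1 -> C n.
Hypothesis ev_src : forall i k n (h : k <= n) x, ev i (csrc h x) = src h (ev i x).
Hypothesis ev_tgt : forall i k n (h : k <= n) x, ev i (ctgt h x) = tgt h (ev i x).
Hypothesis ev_unit :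
  forall i k n (h : k <= n) x, ev i (cunit h x) = iunit h (ev i x).
Hypothesis ev_comp : forall i k n (h : k < n) x1 x0 e e',
  ev i (@ccomp k n h x1 x0 e) = comp h (ev i x1) (ev i x0) e'.

Let ev_cat i k n (h : k < n) x1 x0 (e : ctgt (ltnW h) x0 = csrc (ltnW h) x1) :
  tgt (ltnW h) (ev i x0) = src (ltnW h) (ev i x1).
Proof. by rewrite -ev_tgt -ev_src e. Qed.

Let ev_compE i k n (h : k < n) x1 x0 e :
  ev i (@ccomp k n h x1 x0 e) = comp h (ev i x1) (ev i x0) (ev_cat i e).
Proof. exact: ev_comp. Qed.

Definition joint_oocat : oocat.
Proof.
refine (@OoCat C csrc ctgt cunit ccomp
  _ _ _ _ _ _ _ _ _ _ _ _ _ _ _ _ _ _ _);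
intros; apply: ev_inj => a; rewrite ?(ev_src, ev_tgt, ev_unit, ev_compE).
- exact: src_id.
- exact: tgt_id.
- exact: src_src.
- exact: tgt_tgt.
- exact: src_tgt.
- exact: tgt_src.
- exact: unit_id.
- exact: unit_unit.
- exact: src_unit.
- exact: tgt_unit.
- exact: src_comp.
- exact: tgt_comp.
- have e1 := ev_cat a e'; rewrite !ev_src in e1.
  by rewrite (src_comp_gt _ _ _ e1); apply: comp_irr; rewrite ev_src.
- have e1 := ev_cat a e'; rewrite !ev_tgt in e1.
  by rewrite (tgt_comp_gt _ _ _ e1); apply: comp_irr; rewrite ev_tgt.
- have e1 := ev_cat a e21_0; have e2 := ev_cat a e2_10.
  rewrite !ev_compE in e1 e2.
  have := @comp_assoc _ _ _ h _ _ _ (ev_cat a e21) (ev_cat a e10) e1 e2.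
  move=> E; apply: etrans (etrans E _); last rewrite ev_compE;
    by apply: comp_irr; rewrite ?ev_compE.
- have e1 := ev_cat a e; rewrite ev_unit ev_src in e1.
  by rewrite -[RHS](comp_unitr h _ e1); apply: comp_irr; rewrite ?ev_unit ?ev_src.
- have e1 := ev_cat a e; rewrite ev_unit ev_tgt in e1.
  by rewrite -[RHS](comp_unitl h _ e1); apply: comp_irr; rewrite ?ev_unit ?ev_tgt.
- have e1 := ev_cat a e'; rewrite !ev_unit in e1.
  by rewrite (unit_comp _ e1); apply: comp_irr; rewrite ev_unit.
- have e2 := ev_cat a e10; have e3 := ev_cat a eyx.
  rewrite !ev_compE in e2 e3.
  have E := @interchange _ _ _ _ hij hjn hin _ _ _ _ (ev_cat a ey) (ev_cat a ex)
    e3 (ev_cat a e1) (ev_cat a e0) e2.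
  apply: etrans (etrans E _); last rewrite ev_compE;
    by apply: comp_irr; rewrite ?ev_compE.
Defined.

Definition joint_proj (i : I) : oofunctor joint_oocat (Y i).
Proof.
exact: (@OoFunctor joint_oocat (Y i) (ev i)
  (@ev_src i) (@ev_tgt i) (@ev_unit i) (@ev_comp i)).
Defined.

Section Pairing.
Variables (A : oocat) (F : forall i, oofunctor A (Y i)).
Variable g : forall n, cell A n -> C n.
Hypothesis ev_g : forall i n x, ev i (@g n x) = F i n x.

Definition joint_pairing : oofunctor A joint_oocat.
Proof.
refine (@OoFunctor A joint_oocat g _ _ _ _);
intros; apply: ev_inj => a; rewrite ev_g.
- by rewrite ev_src ev_g fmap_src.
- by rewrite ev_tgt ev_g fmap_tgt.
- by rewrite ev_unit ev_g fmap_unit.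
- have e1 : tgt (ltnW h) (F a n x0) = src (ltnW h) (F a n x1).
    by rewrite -fmap_tgt -fmap_src e.
  by rewrite ev_compE (fmap_comp _ _ e1); apply: comp_irr; rewrite ev_g.
Defined.

End Pairing.
End Jointly.
(** * Trivial fibrations in terms of cells *)

(** An oo-functor out of a globe is a globular family of cells indexed by the
    non-trivial cells of the globe.  Compatibility with composites amounts to
    the unit laws, since one of two composable cells of a globe is always a
    unit. *)
Section GlobeMaps.
Variable V : pred (nat * bool).
Hypothesis Vdown : forall k b i c, V (k, b) -> i < k -> V (i, c).
Variable Y : oocat.
Variable e : forall k b, V (k, b) -> cell Y k.
Hypothesis e_src : forall k b (Vk : V (k, b)) i (ik : i < k) (Vi : V (i, false)),
  src (ltnW ik) (e Vk) = e Vi.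
Hypothesis e_tgt : forall k b (Vk : V (k, b)) i (ik : i < k) (Vi : V (i, true)),
  tgt (ltnW ik) (e Vk) = e Vi.

Let gcell_mem m k b (H : V (k, b) && ((k, b).1 <= m)) : V (k, b).
Proof. by case/andP: H. Qed.

Let gcell_le m k b (H : V (k, b) && ((k, b).1 <= m)) : k <= m.
Proof. by case/andP: H. Qed.

Definition globe_fun m (c : gcell V m) : cell Y m :=
  match c with
  | exist (k, b) H => iunit (gcell_le H) (e (gcell_mem H))
  end.

Lemma globe_funE m (c : gcell V m) k b (Vk : V (k, b)) (km : k <= m) :
  val c = (k, b) -> globe_fun c = iunit km (e Vk).
Proof.
case: c => [[k' b'] H] /= [E1 E2]; subst k' b'.
by rewrite (bool_irrelevance (gcell_mem H) Vk) (bool_irrelevance (gcell_le H) km).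
Qed.

Let gcellP m (c : gcell V m) :
  exists k b (Vk : V (k, b)) (km : k <= m), val c = (k, b).
Proof. by case: c => [[k b] H] /=; have /andP[Vk km] := H; exists k, b. Qed.

Definition globe_map : oofunctor (globular Vdown) Y.
Proof.
refine (@OoFunctor (globular Vdown) Y globe_fun _ _ _ _).
- move=> i m h c; have [k [b [Vk [km cE]]]] := gcellP c.
  rewrite (globe_funE Vk km cE); have [ki|ik] := leqP k i.
    rewrite (globe_funE Vk ki); last by rewrite /= /gbd_val cE /= ki.
    by rewrite -(unit_unit ki h km) src_unit.
  have Vi := Vdown false Vk ik.
  rewrite (globe_funE Vi (leqnn i)); last by rewrite /= /gbd_val cE /= leqNgt ik.
  by rewrite unit_id -(src_src (ltnW ik) km h) src_unit (e_src _ _ Vi).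
- move=> i m h c; have [k [b [Vk [km cE]]]] := gcellP c.
  rewrite (globe_funE Vk km cE); have [ki|ik] := leqP k i.
    rewrite (globe_funE Vk ki); last by rewrite /= /gbd_val cE /= ki.
    by rewrite -(unit_unit ki h km) tgt_unit.
  have Vi := Vdown true Vk ik.
  rewrite (globe_funE Vi (leqnn i)); last by rewrite /= /gbd_val cE /= leqNgt ik.
  by rewrite unit_id -(tgt_tgt (ltnW ik) km h) tgt_unit (e_tgt _ _ Vi).
- move=> i m h c; have [k [b [Vk [km cE]]]] := gcellP c.
  rewrite (globe_funE Vk (leq_trans km h)) //.
  by rewrite (globe_funE Vk km cE) (unit_unit _ _ (leq_trans km h)).
- move=> i m h c1 c0 E E'.
  have [k0 [b0 [V0 [km0 c0E]]]] := gcellP c0.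
  have [k1 [b1 [V1 [km1 c1E]]]] := gcellP c1.
  rewrite /= /gcomp c0E /=; have [ki0|ik0] := leqP k0 i.
    have F0 : globe_fun c0 = iunit (ltnW h) (src (ltnW h) (globe_fun c1)).
      rewrite -E' (globe_funE V0 km0 c0E) -(unit_unit ki0 (ltnW h) km0).
      by rewrite tgt_unit.
    have E1 := E'; rewrite F0 in E1.
    by rewrite -[LHS](comp_unitr h _ E1); exact: comp_irr.
  have ki1 : k1 <= i.
    move/(congr1 val): E; rewrite /= /gbd_val c0E c1E /= leqNgt ik0 /=.
    by case: leqP.
  have F1 : globe_fun c1 = iunit (ltnW h) (tgt (ltnW h) (globe_fun c0)).
    rewrite E' (globe_funE V1 km1 c1E) -(unit_unit ki1 (ltnW h) km1).
    by rewrite src_unit.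
  have E1 := E'; rewrite F1 in E1.
  by rewrite -[LHS](comp_unitl h _ E1); exact: comp_irr.
Defined.

End GlobeMaps.

Definition globe_cell (V : pred (nat * bool)) k b (Vk : V (k, b)) : gcell V k :=
  exist (fun c => V c && (c.1 <= k)) (k, b) (introT andP (conj Vk (leqnn k))).

Lemma globe_functor_ext (V : pred (nat * bool))
    (Vdown : forall k b i c, V (k, b) -> i < k -> V (i, c)) (Y : oocat)
    (F G : oofunctor (globular Vdown) Y) :
  (forall k b (Vk : V (k, b)), F k (globe_cell Vk) = G k (globe_cell Vk)) ->
  oofunctor_eq F G.
Proof.
move=> FG m c.
have [k [b [Vk [km cE]]]] : exists k b (Vk : V (k, b)) (km : k <= m), val c = (k, b).
  by case: c => [[k b] H] /=; have /andP[Vk km] := H; exists k, b.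
have -> : c = iunit (o := globular Vdown) km (globe_cell Vk) by exact: val_inj.
by rewrite !fmap_unit FG.
Qed.

Lemma globe_map_cell (V : pred (nat * bool)) Vdown Y e e_src e_tgt k b
    (Vk : V (k, b)) :
  @globe_map V Vdown Y e e_src e_tgt k (globe_cell Vk) = e k b Vk.
Proof.
apply: etrans (unit_id (leqnn k) _).
exact: (@globe_funE V Y e k (globe_cell Vk) k b Vk (leqnn k) erefl).
Qed.

Definition parallel (X : oocat) n (a b : cell X n) : Prop :=
  forall i (h : i < n), src (ltnW h) a = src (ltnW h) b /\
                        tgt (ltnW h) a = tgt (ltnW h) b.

(** Lifting against S^(n-1) -> D_n in terms of cells: oo-functors out of D_n
    are n-cells, and those out of S^n are parallel pairs of n-cells.  The first
    clause is the case n = 0, where the sphere is empty. *)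
Definition cell_lifting (Y Z : oocat) (q : oofunctor Y Z) : Prop :=
  (forall z : cell Z 0, exists y, q 0 y = z) /\
  (forall n (a b : cell Y n) (z : cell Z n.+1), parallel a b ->
     src (leqnSn n) z = q n a -> tgt (leqnSn n) z = q n b ->
     exists c : cell Y n.+1,
       [/\ src (leqnSn n) c = a, tgt (leqnSn n) c = b & q n.+1 c = z]).

Lemma disk_cell_le n k b : disk_cell n (k, b) -> k <= n.
Proof. by rewrite /disk_cell /=; case: ltngtP. Qed.

Section DiskMaps.
Variables (Y : oocat) (n : nat) (y : cell Y n).

Definition bd_cell (b : bool) i (h : i <= n) : cell Y i :=
  if b then tgt h y else src h y.

Let de k b (V : disk_cell n (k, b)) : cell Y k := bd_cell b (disk_cell_le V).

Let de_src k b (Vk : disk_cell n (k, b)) i (ik : i < k) (Vi : disk_cell n (i, false)) :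
  src (ltnW ik) (de Vk) = de Vi.
Proof.
rewrite /de /bd_cell; case: b Vk => Vk; first exact: src_tgt.
exact: src_src.
Qed.

Let de_tgt k b (Vk : disk_cell n (k, b)) i (ik : i < k) (Vi : disk_cell n (i, true)) :
  tgt (ltnW ik) (de Vk) = de Vi.
Proof.
rewrite /de /bd_cell; case: b Vk => Vk; last exact: tgt_src.
exact: tgt_tgt.
Qed.

Definition disk_map : oofunctor (disk n) Y :=
  globe_map (@disk_cell_down n) de_src de_tgt.

Lemma disk_mapE k b (Vk : disk_cell n (k, b)) (kn : k <= n) :
  disk_map k (globe_cell Vk) = bd_cell b kn.
Proof.
rewrite /disk_map [LHS]globe_map_cell /de.
by rewrite (bool_irrelevance (disk_cell_le Vk) kn).
Qed.

End DiskMaps.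

Lemma disk_top n : disk_cell n (n, false).
Proof. by rewrite /disk_cell /= eqxx orbT. Qed.

Lemma bd_cell_fmap (Y Z : oocat) (q : oofunctor Y Z) n (y : cell Y n) b i (h : i <= n) :
  q i (bd_cell y b h) = bd_cell (q n y) b h.
Proof. by rewrite /bd_cell; case: b; rewrite ?fmap_src ?fmap_tgt. Qed.

Lemma disk_functorE n (Y : oocat) (v : oofunctor (disk n) Y) :
  oofunctor_eq v (disk_map (v n (globe_cell (disk_top n)))).
Proof.
apply: globe_functor_ext => k b Vk.
have kn := disk_cell_le Vk.
rewrite (disk_mapE _ _ kn) -bd_cell_fmap; congr (v k _).
have b0 : k = n -> b = false.
  by move=> kn'; subst k; move: Vk; rewrite /disk_cell /= ltnn eqxx /=; case: b.
apply: val_inj; rewrite /bd_cell; case: b Vk b0 => Vk b0 /=; rewrite /gbd_val /=.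
  by case: leqP => // nk; have := b0 (anti_leq (introT andP (conj kn nk))).
by case: leqP => // nk; rewrite (anti_leq (introT andP (conj kn nk))).
Qed.

Section SphereMaps.
Variables (Y : oocat) (n : nat) (y : bool -> cell Y n).
Hypothesis yP : parallel (y false) (y true).

Let sphere_le k b : sphere_cell n.+1 (k, b) -> k <= n. Proof. by []. Qed.

Let se k b (V : sphere_cell n.+1 (k, b)) : cell Y k := bd_cell (y b) b (sphere_le V).

Let y_src b i (h : i < n) : src (ltnW h) (y b) = src (ltnW h) (y false).
Proof. by case: b => //; have [-> _] := yP h. Qed.

Let y_tgt b i (h : i < n) : tgt (ltnW h) (y b) = tgt (ltnW h) (y true).
Proof. by case: b => //; have [_ ->] := yP h. Qed.

Let se_src k b (Vk : sphere_cell n.+1 (k, b)) i (ik : i < k)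
    (Vi : sphere_cell n.+1 (i, false)) : src (ltnW ik) (se Vk) = se Vi.
Proof.
have h : i < n := leq_trans ik (sphere_le Vk).
rewrite /se /bd_cell (bool_irrelevance (sphere_le Vi) (ltnW h)) -(y_src b).
by case: b Vk => Vk; [exact: src_tgt|exact: src_src].
Qed.

Let se_tgt k b (Vk : sphere_cell n.+1 (k, b)) i (ik : i < k)
    (Vi : sphere_cell n.+1 (i, true)) : tgt (ltnW ik) (se Vk) = se Vi.
Proof.
have h : i < n := leq_trans ik (sphere_le Vk).
rewrite /se /bd_cell (bool_irrelevance (sphere_le Vi) (ltnW h)) -(y_tgt b).
by case: b Vk => Vk; [exact: tgt_tgt|exact: tgt_src].
Qed.

Definition sphere_map : oofunctor (sphere n.+1) Y :=
  globe_map (@sphere_cell_down n.+1) se_src se_tgt.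

Lemma sphere_mapE k b (Vk : sphere_cell n.+1 (k, b)) (kn : k <= n) :
  sphere_map k (globe_cell Vk) = bd_cell (y b) b kn.
Proof.
rewrite /sphere_map [LHS]globe_map_cell /se.
by rewrite (bool_irrelevance (sphere_le Vk) kn).
Qed.

End SphereMaps.

Lemma sphere_top n b : sphere_cell n.+1 (n, b).
Proof. exact: leqnn. Qed.

Lemma sphere_functor_parallel n (Y : oocat) (u : oofunctor (sphere n.+1) Y) :
  parallel (u n (globe_cell (sphere_top n false))) (u n (globe_cell (sphere_top n true))).
Proof.
move=> i h; rewrite -!fmap_src -!fmap_tgt.
by split; congr (u i _); apply: val_inj; rewrite /= /gbd_val /= leqNgt h.
Qed.

Lemma bd_cell_bd (Y : oocat) n (y : cell Y n.+1) b k (h : k <= n) (h' : k <= n.+1) :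
  bd_cell (bd_cell y b (leqnSn n)) b h = bd_cell y b h'.
Proof. by case: b; [exact: tgt_tgt|exact: src_src]. Qed.

Lemma bd_cell_id (Y : oocat) n (y : cell Y n) b (h : n <= n) : bd_cell y b h = y.
Proof. by case: b; [exact: tgt_id|exact: src_id]. Qed.

Lemma sphere_functorE n (Y : oocat) (u : oofunctor (sphere n.+1) Y) k b
    (Vk : sphere_cell n.+1 (k, b)) (kn : k <= n) :
  u k (globe_cell Vk) = bd_cell (u n (globe_cell (sphere_top n b))) b kn.
Proof.
rewrite -bd_cell_fmap; congr (u k _); apply: val_inj.
rewrite /bd_cell; case: b Vk => Vk /=; rewrite /gbd_val /=; case: leqP => // nk;
  by rewrite (anti_leq (introT andP (conj kn nk))).
Qed.

Lemma oofunctor_disk_lift n (Y Z : oocat) (q : oofunctor Y Z) (c : cell Y n)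
    (v : oofunctor (disk n) Z) :
  q n c = v n (globe_cell (disk_top n)) -> oofunctor_eq (oocomp q (disk_map c)) v.
Proof.
move=> qc m x; rewrite [RHS]disk_functorE -qc; move: m x.
apply: globe_functor_ext => k b Vk; have kn := disk_cell_le Vk.
rewrite [RHS](disk_mapE _ _ kn) -bd_cell_fmap -(disk_mapE c Vk kn).
by [].
Qed.

Lemma sphere_incl_cell n k b (Vk : sphere_cell n (k, b)) (Vk' : disk_cell n (k, b)) :
  sphere_incl n k (globe_cell Vk) = globe_cell Vk'.
Proof. exact: val_inj. Qed.

Lemma cell_lifting_trivial_fibration (Y Z : oocat) (q : oofunctor Y Z) :
  cell_lifting q -> trivial_fibration q.
Proof.
move=> [l0 lS] [|n] u v quv.
  have [y qy] := l0 (v 0 (globe_cell (disk_top 0))).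
  exists (disk_map y); split; first by apply: globe_functor_ext.
  exact: oofunctor_disk_lift.
pose a b := globe_cell (sphere_top n b).
have quvE b : q n (u n (a b)) = bd_cell (v n.+1 (globe_cell (disk_top n.+1))) b (leqnSn n).
  rewrite -bd_cell_fmap; apply: etrans (quv n (a b)) _; congr (v n _).
  by apply: val_inj; case: b; rewrite /= /gbd_val /= ltnn.
have [|||c [cs ct qc]] :=
  lS n (u n (a false)) (u n (a true)) (v n.+1 (globe_cell (disk_top n.+1))).
- exact: sphere_functor_parallel.
- by rewrite quvE.
- by rewrite quvE.
exists (disk_map c); split; last exact: oofunctor_disk_lift.
apply: globe_functor_ext => k b Vk; have kn : k <= n by [].
have Vk' := sphere_disk_cell Vk.
have kn' : k <= n.+1 by exact: leq_trans kn (leqnSn n).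
rewrite [RHS](sphere_functorE _ _ kn) -[LHS]/(disk_map c k (sphere_incl n.+1 k (globe_cell Vk))).
rewrite (sphere_incl_cell Vk Vk') (disk_mapE _ _ kn').
rewrite -(bd_cell_bd _ _ kn).
by have -> : bd_cell c b (leqnSn n) = u n (globe_cell (sphere_top n b)) by case: (b).
Qed.

Lemma trivial_fibration_cell_lifting (Y Z : oocat) (q : oofunctor Y Z) :
  trivial_fibration q -> cell_lifting q.
Proof.
move=> qtf; split=> [z|n a b z abP sz tz].
  have u : oofunctor (sphere 0) Y.
    have S0 k c : sphere_cell 0 (k, c) -> cell Y k by [].
    by refine (globe_map (e := S0) _ _ _).
  have [|w [_ qw]] := qtf 0 u (disk_map z); first by apply: globe_functor_ext.
  exists (w 0 (globe_cell (disk_top 0))); apply: etrans (qw 0 (globe_cell (disk_top 0))) _.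
  by rewrite [LHS](disk_mapE _ _ (leqnn 0)) bd_cell_id.
pose y c := if c then b else a.
have yP : parallel (y false) (y true) by [].
have [|w [wu qw]] := qtf n.+1 (sphere_map yP) (disk_map z).
  apply: globe_functor_ext => k c Vk; have kn : k <= n by [].
  have kn' : k <= n.+1 by exact: leq_trans kn (leqnSn n).
  rewrite -[LHS]/(q k (sphere_map yP k (globe_cell Vk))) (sphere_mapE _ _ kn).
  rewrite -[RHS]/(disk_map z k (sphere_incl n.+1 k (globe_cell Vk))).
  rewrite (sphere_incl_cell Vk (sphere_disk_cell Vk)).
  rewrite (disk_mapE _ _ kn') -(bd_cell_bd _ _ kn) bd_cell_fmap.
  by have -> : q n (y c) = bd_cell z c (leqnSn n) by case: (c).
pose top := globe_cell (disk_top n.+1); exists (w n.+1 top).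
have wE c : bd_cell (w n.+1 top) c (leqnSn n) = y c.
  rewrite -bd_cell_fmap.
  rewrite -[RHS](bd_cell_id _ c (leqnn n)) -(sphere_mapE yP (sphere_top n c)) -wu /=.
  by congr (w n _); apply: val_inj; case: c; rewrite /= /gbd_val /= ltnn.
split; [exact: (wE false)|exact: (wE true)|].
apply: etrans (qw n.+1 top) _.
by rewrite [LHS](disk_mapE _ _ (leqnn _)) bd_cell_id.
Qed.
(** * Pullbacks *)

Section Pullback.
Variables (P Y Z : oocat) (v : oofunctor P Z) (q : oofunctor Y Z).

Definition pb_cell (n : nat) : Type := {c : cell P n * cell Y n | v n c.1 = q n c.2}.

Let pb_factor (b : bool) : oocat := if b then P else Y.

Let pb_ev (b : bool) n (c : pb_cell n) : cell (pb_factor b) n :=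
  match b return cell (pb_factor b) n with
  | true => (proj1_sig c).1
  | false => (proj1_sig c).2
  end.

Let pb_mk n (x : cell P n) (y : cell Y n) (e : v n x = q n y) : pb_cell n :=
  exist _ (x, y) e.

Lemma pb_cell_ext n (c c' : pb_cell n) :
  (proj1_sig c).1 = (proj1_sig c').1 -> (proj1_sig c).2 = (proj1_sig c').2 -> c = c'.
Proof.
case: c c' => [[x y] e] [[x' y'] e'] /= xx' yy'; subst x' y'.
by rewrite (Prop_irrelevance e e').
Qed.

Let pb_ev_inj n (c c' : pb_cell n) : (forall b, pb_ev b c = pb_ev b c') -> c = c'.
Proof. by move=> cc'; apply: pb_cell_ext; [exact: (cc' true)|exact: (cc' false)]. Qed.

Let pb_src k n (h : k <= n) (c : pb_cell n) : pb_cell k.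
Proof.
apply: (@pb_mk k (src h (proj1_sig c).1) (src h (proj1_sig c).2)).
abstract (by rewrite !fmap_src; case: c => c /= ->).
Defined.

Let pb_tgt k n (h : k <= n) (c : pb_cell n) : pb_cell k.
Proof.
refine (@pb_mk k (tgt h (proj1_sig c).1) (tgt h (proj1_sig c).2) _);
  abstract (rewrite !fmap_tgt; by case: c => c /= ->).
Defined.

Let pb_unit k n (h : k <= n) (c : pb_cell k) : pb_cell n.
Proof.
refine (@pb_mk n (iunit h (proj1_sig c).1) (iunit h (proj1_sig c).2) _);
  abstract (rewrite !fmap_unit; by case: c => c /= ->).
Defined.

Let pb_comp_comm k n (h : k < n) (c1 c0 : pb_cell n)
    (e : pb_tgt (ltnW h) c0 = pb_src (ltnW h) c1) :
  v n (comp h (proj1_sig c1).1 (proj1_sig c0).1 (congr1 (fun c => (proj1_sig c).1) e)) =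
  q n (comp h (proj1_sig c1).2 (proj1_sig c0).2 (congr1 (fun c => (proj1_sig c).2) e)).
Proof.
set ex := congr1 _ e; set ey := congr1 _ e.
have e1 : tgt (ltnW h) (v n (proj1_sig c0).1) = src (ltnW h) (v n (proj1_sig c1).1).
  by rewrite -fmap_tgt -fmap_src; congr (v _ _); exact: ex.
have e2 : tgt (ltnW h) (q n (proj1_sig c0).2) = src (ltnW h) (q n (proj1_sig c1).2).
  by rewrite -fmap_tgt -fmap_src; congr (q _ _); exact: ey.
rewrite (fmap_comp _ _ e1) (fmap_comp _ _ e2).
by apply: comp_irr; [exact: (proj2_sig c1)|exact: (proj2_sig c0)].
Qed.

Let pb_comp k n (h : k < n) (c1 c0 : pb_cell n)
    (e : pb_tgt (ltnW h) c0 = pb_src (ltnW h) c1) : pb_cell n :=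
  pb_mk (pb_comp_comm e).

Let pb_ev_src b k n (h : k <= n) c : pb_ev b (pb_src h c) = src h (pb_ev b c).
Proof. by case: b. Qed.
Let pb_ev_tgt b k n (h : k <= n) c : pb_ev b (pb_tgt h c) = tgt h (pb_ev b c).
Proof. by case: b. Qed.
Let pb_ev_unit b k n (h : k <= n) c : pb_ev b (pb_unit h c) = iunit h (pb_ev b c).
Proof. by case: b. Qed.
Let pb_ev_comp b k n (h : k < n) c1 c0 e e' :
  pb_ev b (@pb_comp k n h c1 c0 e) = comp h (pb_ev b c1) (pb_ev b c0) e'.
Proof. by case: b e' => e'; exact: comp_irr. Qed.

Definition pullback : oocat :=
  joint_oocat pb_ev_inj pb_ev_src pb_ev_tgt pb_ev_unit pb_ev_comp.

Definition pb_fst : oofunctor pullback P :=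
  joint_proj pb_ev_inj pb_ev_src pb_ev_tgt pb_ev_unit pb_ev_comp true.

Definition pb_snd : oofunctor pullback Y :=
  joint_proj pb_ev_inj pb_ev_src pb_ev_tgt pb_ev_unit pb_ev_comp false.

Lemma pb_comm : oocomp v pb_fst = oocomp q pb_snd.
Proof. by apply: oofunctor_ext => n c; exact: (proj2_sig c). Qed.

Lemma pb_ext n (c c' : cell pullback n) :
  pb_fst n c = pb_fst n c' -> pb_snd n c = pb_snd n c' -> c = c'.
Proof. exact: pb_cell_ext. Qed.

Lemma pb_exists n (x : cell P n) (y : cell Y n) : v n x = q n y ->
  exists c : cell pullback n, pb_fst n c = x /\ pb_snd n c = y.
Proof. by move=> e; exists (pb_mk e). Qed.

Section PullbackPairing.
Variables (A : oocat) (a : oofunctor A P) (b : oofunctor A Y).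
Hypothesis ab : oofunctor_eq (oocomp v a) (oocomp q b).

Let pair_fun n (x : cell A n) : pb_cell n := pb_mk (ab x).

Let pair_leg (c : bool) : oofunctor A (pb_factor c) :=
  match c return oofunctor A (pb_factor c) with true => a | false => b end.

Let pair_funE c n (x : cell A n) : pb_ev c (pair_fun x) = pair_leg c n x.
Proof. by case: c. Qed.

Definition pb_pair : oofunctor A pullback :=
  joint_pairing pb_ev_inj pb_ev_src pb_ev_tgt pb_ev_unit pb_ev_comp pair_funE.

Lemma pb_pair_snd : oocomp pb_snd pb_pair = b.
Proof. exact: oofunctor_ext. Qed.

End PullbackPairing.

Lemma pullback_cell_lifting : cell_lifting q -> cell_lifting pb_fst.
Proof.
move=> [q0 qS]; split=> [x|n a b x ab sx tx].
  by have [y /esym vx] := q0 (v 0 x); have [c [<- _]] := pb_exists vx; exists c.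
have qv k (c : cell pullback k) : q k (pb_snd k c) = v k (pb_fst k c).
  by have := congr1 (fun F : oofunctor pullback Z => F k c) pb_comm; exact: esym.
have [|||y [sy ty qy]] := qS n (pb_snd n a) (pb_snd n b) (v n.+1 x).
- by move=> i h; rewrite -!fmap_src -!fmap_tgt; have [-> ->] := ab i h.
- by rewrite -fmap_src sx qv.
- by rewrite -fmap_tgt tx qv.
have [c [cx cy]] := pb_exists (esym qy); exists c; split => //.
- by apply: pb_ext; rewrite fmap_src ?cx ?cy.
- by apply: pb_ext; rewrite fmap_tgt ?cx ?cy.
Qed.

End Pullback.

Lemma trivial_fibration_comp (X Y Z : oocat) (q : oofunctor Y Z) (p : oofunctor X Y) :
  trivial_fibration q -> trivial_fibration p -> trivial_fibration (oocomp q p).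
Proof.
move=> qtf ptf n u v uv.
have [w [wu qw]] := qtf n (oocomp p u) v uv.
have [w' [w'u pw']] := ptf n u w (fun m c => esym (wu m c)).
exists w'; split=> // m c; rewrite -qw /= -pw' //.
Qed.

Lemma cofibration_comp (A B C : oocat) (j : oofunctor B C) (i : oofunctor A B) :
  cofibration j -> cofibration i -> cofibration (oocomp j i).
Proof.
move=> jcof icof Y Z q qtf u v uv.
have [w [wu qw]] := icof Y Z q qtf u (oocomp v j) uv.
have [w' [w'w qw']] := jcof Y Z q qtf w v qw.
by exists w'; split=> // m c; rewrite -wu /= -w'w.
Qed.

(** * The factorization *)

Section Factorization.
Variables (A W : oocat) (j : oofunctor A W).

Definition fillable (Y : oocat) (q : oofunctor Y W) n (a b : cell Y n)
    (z : cell W n.+1) : Prop :=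
  [/\ parallel a b, src (leqnSn n) z = q n a & tgt (leqnSn n) z = q n b].

(** Algebras for chosen liftings, under A and over W.  The operation [la_fill]
    is total, with laws only where a filler makes sense: this keeps proofs out
    of its arguments. *)
Record lifting_algebra : Type := LiftingAlgebra {
  la_oocat :> oocat;
  la_proj : oofunctor la_oocat W;
  la_unit : oofunctor A la_oocat;
  la_comm : oofunctor_eq (oocomp la_proj la_unit) j;
  la_point : cell W 0 -> cell la_oocat 0;
  la_pointP : forall z, la_proj 0 (la_point z) = z;
  la_fill : forall n, cell la_oocat n -> cell la_oocat n -> cell W n.+1 ->
    cell la_oocat n.+1;
  la_fill_src : forall n (a b : cell la_oocat n) z, fillable la_proj a b z ->
    src (leqnSn n) (la_fill a b z) = a;
  la_fill_tgt : forall n (a b : cell la_oocat n) z, fillable la_proj a b z ->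
    tgt (leqnSn n) (la_fill a b z) = b;
  la_fill_proj : forall n (a b : cell la_oocat n) z, fillable la_proj a b z ->
    la_proj n.+1 (la_fill a b z) = z
}.

(** Every operation is a constructor, sources, targets and units included.  No
    law is built in and only dimensions are tracked, so that terms form a plain
    inductive family and are evaluated by recursion. *)
Inductive term : nat -> Type :=
| t_const n (a : cell A n) : term n
| t_point (z : cell W 0) : term 0
| t_fill n (a b : term n) (z : cell W n.+1) : term n.+1
| t_src i n (h : i <= n) (x : term n) : term i
| t_tgt i n (h : i <= n) (x : term n) : term i
| t_unit i n (h : i <= n) (x : term i) : term n
| t_comp i n (h : i < n) (x1 x0 : term n) : term n.

Fixpoint eval (Y : lifting_algebra) n (r : term n) : cell Y n :=
  match r with
  | t_const n a => la_unit Y n a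
  | t_point z => la_point Y z
  | t_fill n a b z => la_fill (eval Y a) (eval Y b) z
  | t_src i n h x => src h (eval Y x)
  | t_tgt i n h x => tgt h (eval Y x)
  | t_unit i n h x => iunit h (eval Y x)
  | t_comp i n h x1 x0 => comp_or_left h (eval Y x1) (eval Y x0)
  end.

(** A term is well-formed when, in all algebras at once, the fillers and
    composites that it mentions exist.  Quantifying over algebras dispenses
    with any explicit description of the congruence on terms. *)
Fixpoint well_formed n (r : term n) : Prop :=
  match r with
  | t_const _ _ | t_point _ => True
  | t_fill n a b z => [/\ well_formed a, well_formed b &
      forall Y, fillable (la_proj Y) (eval Y a) (eval Y b) z]
  | t_src _ _ _ x | t_tgt _ _ _ x | t_unit _ _ _ x => well_formed x
  | t_comp i n h x1 x0 => [/\ well_formed x1, well_formed x0 &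
      forall Y, tgt (ltnW h) (eval Y x0) = src (ltnW h) (eval Y x1)]
  end.

(** Initiality in disguise: a morphism of algebras preserves values.
    Well-formedness is needed because the total operations agree with the
    meaningful ones only where these are defined. *)
Lemma eval_morph (Y Y' : lifting_algebra) (phi : oofunctor Y Y') :
  (forall n a, phi n (la_unit Y n a) = la_unit Y' n a) ->
  (forall z, phi 0 (la_point Y z) = la_point Y' z) ->
  (forall n (a b : cell Y n) z, fillable (la_proj Y) a b z ->
     fillable (la_proj Y') (phi n a) (phi n b) z ->
     phi n.+1 (la_fill a b z) = la_fill (phi n a) (phi n b) z) ->
  forall n (r : term n), well_formed r -> phi n (eval Y r) = eval Y' r.
Proof.
move=> phi_unit phi_point phi_fill n.
elim=> {n} [n a|z|n a IHa b IHb z|i n h x IH|i n h x IH|i n h x IH|i n h x1 IH1 x0 IH0] /=.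
- by move=> _; exact: phi_unit.
- by move=> _; exact: phi_point.
- move=> [/IHa Ea /IHb Eb ab]; rewrite -Ea -Eb phi_fill ?Ea ?Eb //.
- by move=> /IH <-; exact: fmap_src.
- by move=> /IH <-; exact: fmap_tgt.
- by move=> /IH <-; exact: fmap_unit.
- move=> [/IH1 E1 /IH0 E0 e]; rewrite (comp_or_leftE (e Y)) (comp_or_leftE (e Y')).
  have e' := e Y'; rewrite -E1 -E0 in e'.
  by rewrite (fmap_comp _ _ e'); exact: comp_irr.
Qed.

(** The cells of the initial algebra are the classes of well-formed terms with
    the same value in every algebra.  Algebras are quantified over inside a
    proposition only, so these classes form a type as small as that of terms,
    and the initial algebra is one of the algebras quantified over. *)
Definition is_term_class n (S : term n -> Prop) : Prop :=
  exists r, well_formed r /\ S = (fun r' => forall Y, eval Y r' = eval Y r).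

Definition free_cell (n : nat) : Type := {S : term n -> Prop | is_term_class S}.

Definition free_term n (x : free_cell n) : term n := projT1 (cid (proj2_sig x)).

Lemma free_term_wf n (x : free_cell n) : well_formed (free_term x).
Proof. by rewrite /free_term; case: cid => r []. Qed.

Definition free_class n (r : term n) (rwf : well_formed r) : free_cell n :=
  exist _ (fun r' => forall Y, eval Y r' = eval Y r) (ex_intro _ r (conj rwf erefl)).

Definition free_value (Y : lifting_algebra) n (x : free_cell n) : cell Y n :=
  eval Y (free_term x).

Lemma free_value_class Y n (r : term n) (rwf : well_formed r) :
  free_value Y (free_class rwf) = eval Y r.
Proof.
rewrite /free_value /free_term; case: cid => /= r' [_ E].
have /= E' := congr1 (@^~ r) E.
by have /(_ Y)-> : forall Y', eval Y' r = eval Y' r' by rewrite -E'.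
Qed.

Lemma free_value_inj n (x y : free_cell n) :
  (forall Y, free_value Y x = free_value Y y) -> x = y.
Proof.
rewrite /free_value /free_term; case: x y => [S dS] [T dT] /=.
case: cid => r [rwf ES]; case: cid => s [swf ET] /= rs.
have ST : S = T.
  by rewrite ES ET; apply: functional_extensionality_dep => r'; apply: propext;
    split=> E Y; rewrite E ?rs.
by case: T / ST dT ET => dT _; rewrite (Prop_irrelevance dS dT).
Qed.

Let f_src i n (h : i <= n) (x : free_cell n) : free_cell i :=
  @free_class i (t_src h (free_term x)) (free_term_wf x).
Let f_tgt i n (h : i <= n) (x : free_cell n) : free_cell i :=
  @free_class i (t_tgt h (free_term x)) (free_term_wf x).
Let f_unit i n (h : i <= n) (x : free_cell i) : free_cell n :=
  @free_class n (t_unit h (free_term x)) (free_term_wf x).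

Let free_value_src Y i n (h : i <= n) x :
  free_value Y (f_src h x) = src h (free_value Y x).
Proof. exact: free_value_class. Qed.
Let free_value_tgt Y i n (h : i <= n) x :
  free_value Y (f_tgt h x) = tgt h (free_value Y x).
Proof. exact: free_value_class. Qed.
Let free_value_unit Y i n (h : i <= n) x :
  free_value Y (f_unit h x) = iunit h (free_value Y x).
Proof. exact: free_value_class. Qed.

Let f_comp_wf i n (h : i < n) (x1 x0 : free_cell n)
    (e : f_tgt (ltnW h) x0 = f_src (ltnW h) x1) :
  well_formed (t_comp h (free_term x1) (free_term x0)).
Proof.
split; [exact: free_term_wf|exact: free_term_wf|move=> Y].
by rewrite -/(free_value Y x0) -free_value_tgt e free_value_src.
Qed.

Let f_comp i n (h : i < n) (x1 x0 : free_cell n)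
  (e : f_tgt (ltnW h) x0 = f_src (ltnW h) x1) : free_cell n := free_class (f_comp_wf e).

Let free_value_comp Y i n (h : i < n) x1 x0 e e' :
  free_value Y (@f_comp i n h x1 x0 e) = comp h (free_value Y x1) (free_value Y x0) e'.
Proof. by rewrite free_value_class /= (comp_or_leftE e'). Qed.

Definition free_oocat : oocat :=
  joint_oocat free_value_inj free_value_src free_value_tgt free_value_unit
    free_value_comp.

Definition free_eval (Y : lifting_algebra) : oofunctor free_oocat Y :=
  joint_proj free_value_inj free_value_src free_value_tgt free_value_unit free_value_comp
    Y.

Let free_unit_fun n (a : cell A n) : free_cell n := @free_class n (t_const a) I.

Let free_unit_ev Y n (a : cell A n) : free_value Y (free_unit_fun a) = la_unit Y n a.
Proof. exact: free_value_class. Qed.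

Definition free_unit : oofunctor A free_oocat :=
  joint_pairing free_value_inj free_value_src free_value_tgt free_value_unit free_value_comp
    free_unit_ev.

(** W is the terminal algebra; evaluating in it projects terms to W. *)
Definition base_algebra : lifting_algebra.
Proof.
by refine (@LiftingAlgebra W (oofunctor_id W) j (fun _ _ => erefl) id (fun _ => erefl)
  (fun _ _ _ z => z) _ _ _) => n a b z [].
Defined.

Definition free_proj : oofunctor free_oocat W := free_eval base_algebra.

(** The projection of any algebra to W is a morphism to the terminal one. *)
Lemma free_projE Y n (x : cell free_oocat n) :
  la_proj Y n (free_eval Y n x) = free_proj n x.
Proof.
apply: (@eval_morph Y base_algebra (la_proj Y)); last exact: free_term_wf.
- exact: la_comm.
- exact: la_pointP.
- by move=> m a b z ab _; exact: la_fill_proj.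
Qed.

Lemma free_fill_wf n (a b : cell free_oocat n) (z : cell W n.+1) :
  fillable free_proj a b z -> well_formed (t_fill (free_term a) (free_term b) z).
Proof.
move=> [ab sz tz]; split; [exact: free_term_wf|exact: free_term_wf|move=> Y].
rewrite -[eval Y (free_term a)]/(free_eval Y n a) -[eval Y (free_term b)]/(free_eval Y n b).
split; try by rewrite free_projE.
by move=> i h; rewrite -!fmap_src -!fmap_tgt; have [-> ->] := ab i h.
Qed.

Definition free_fill n (a b : cell free_oocat n) (z : cell W n.+1) :
    cell free_oocat n.+1 :=
  if pselect (fillable free_proj a b z) is left ab
  then free_class (free_fill_wf ab) else iunit (leqnSn n) a.

Lemma free_fillE Y n (a b : cell free_oocat n) (z : cell W n.+1) :
  fillable free_proj a b z ->
  free_eval Y n.+1 (free_fill a b z) = la_fill (free_eval Y n a) (free_eval Y n b) z.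
Proof. by rewrite /free_fill; case: pselect => // ab _; exact: free_value_class. Qed.

Definition free_point (z : cell W 0) : cell free_oocat 0 := @free_class 0 (t_point z) I.

Lemma free_pointE Y z : free_eval Y 0 (free_point z) = la_point Y z.
Proof. exact: free_value_class. Qed.

Lemma free_unitE Y n a : free_eval Y n (free_unit n a) = la_unit Y n a.
Proof. exact: free_value_class. Qed.

Lemma free_fillable Y n (a b : cell free_oocat n) z : fillable free_proj a b z ->
  fillable (la_proj Y) (free_eval Y n a) (free_eval Y n b) z.
Proof.
move=> [ab sz tz]; split; rewrite ?free_projE //.
by move=> i h; rewrite -!fmap_src -!fmap_tgt; have [-> ->] := ab i h.
Qed.

Definition free_algebra : lifting_algebra.
Proof.
refine (@LiftingAlgebra free_oocat free_proj free_unit _ free_point _ free_fill _ _ _).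
- by move=> n a; exact: (free_unitE base_algebra a).
- by move=> z; exact: (free_pointE base_algebra z).
- move=> n a b z ab; apply: free_value_inj => Y.
  rewrite -![free_value Y _]/(free_eval Y _ _) fmap_src free_fillE //.
  by apply: la_fill_src; exact: free_fillable.
- move=> n a b z ab; apply: free_value_inj => Y.
  rewrite -![free_value Y _]/(free_eval Y _ _) fmap_tgt free_fillE //.
  by apply: la_fill_tgt; exact: free_fillable.
- by move=> n a b z ab; exact: (free_fillE base_algebra ab).
Defined.

Lemma free_proj_trivial_fibration : trivial_fibration free_proj.
Proof.
apply: cell_lifting_trivial_fibration; split=> [z|n a b z ab sz tz].
  by exists (free_point z); exact: (free_pointE base_algebra z).
have F : fillable free_proj a b z by [].
exists (free_fill a b z); split.
- exact: (@la_fill_src free_algebra).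
- exact: (@la_fill_tgt free_algebra).
- exact: (@la_fill_proj free_algebra).
Qed.

(** Evaluation in any algebra Y is a morphism of algebras, hence sends the
    value of a term in the initial algebra to its value in Y.  As the initial
    algebra is separated by these evaluations, evaluating in it is trivial. *)
Lemma free_eval_id : oofunctor_eq (free_eval free_algebra) (oofunctor_id free_oocat).
Proof.
move=> n x; apply: free_value_inj => Y; rewrite -![free_value Y _]/(free_eval Y _ _).
apply: (@eval_morph free_algebra Y (free_eval Y)); last exact: free_term_wf.
- by move=> m a; exact: (free_unitE Y a).
- by move=> z; exact: (free_pointE Y z).
- by move=> m a b z ab _; exact: free_fillE.
Qed.

(** Against a trivial fibration q : Y -> Z, pull q back along v to a trivial
    fibration d : D -> [free_oocat].  Filling in D by lifting along d the
    fillers of [free_oocat] makes D an algebra and d a morphism of algebras.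
    Evaluation in D is then a section of d by [free_eval_id], and its second
    component is the lift. *)
Section FreeLifting.
Variables (Y Z : oocat) (q : oofunctor Y Z) (qtf : trivial_fibration q).
Variables (u : oofunctor A Y) (v : oofunctor free_oocat Z).
Hypothesis uv : oofunctor_eq (oocomp q u) (oocomp v free_unit).

Let D : oocat := pullback v q.
Let d : oofunctor D free_oocat := pb_fst v q.
Let d_lifting : cell_lifting d :=
  pullback_cell_lifting v (trivial_fibration_cell_lifting qtf).

Let D_unit : oofunctor A D := pb_pair (fun n a => esym (uv a)).

Let D_point (z : cell W 0) : cell D 0 := projT1 (cid (d_lifting.1 (free_point z))).

Let D_fills n (a b : cell D n) (z : cell W n.+1) (c : cell D n.+1) : Prop :=
  [/\ src (leqnSn n) c = a, tgt (leqnSn n) c = b &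
      d n.+1 c = free_fill (d n a) (d n b) z].

Let D_fill n (a b : cell D n) (z : cell W n.+1) : cell D n.+1 :=
  if pselect (exists c, D_fills a b z c) is left ex then projT1 (cid ex)
  else iunit (leqnSn n) a.

Let D_fillP n (a b : cell D n) z :
  fillable (oocomp free_proj d) a b z -> D_fills a b z (D_fill a b z).
Proof.
move=> [ab sz tz]; rewrite /D_fill; case: pselect => [ex|[]]; first by case: cid.
have F : fillable free_proj (d n a) (d n b) z.
  by split=> // i h; rewrite -!fmap_src -!fmap_tgt; have [-> ->] := ab i h.
apply: d_lifting.2 => //; first exact: (@la_fill_src free_algebra).
exact: (@la_fill_tgt free_algebra).
Qed.

Let D_algebra : lifting_algebra.
Proof.
refine (@LiftingAlgebra D (oocomp free_proj d) D_unit _ D_point _ D_fill _ _ _).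
- by move=> n a; exact: (@la_comm free_algebra).
- move=> z; rewrite /D_point /=; case: cid => c /= ->.
  exact: (@la_pointP free_algebra).
- by move=> n a b z /D_fillP[].
- by move=> n a b z /D_fillP[].
- move=> n a b z F; have [_ _ dE] := D_fillP F.
  rewrite -[LHS]/(free_proj n.+1 (d n.+1 (D_fill a b z))) dE.
  apply: (@la_fill_proj free_algebra); case: F => ab sz tz.
  by split=> // i h; rewrite -!fmap_src -!fmap_tgt; have [-> ->] := ab i h.
Defined.

Lemma free_lifting : exists w : oofunctor free_oocat Y,
  oofunctor_eq (oocomp w free_unit) u /\ oofunctor_eq (oocomp q w) v.
Proof.
exists (oocomp (pb_snd v q) (free_eval D_algebra)); split=> n x.
  rewrite -[LHS]/(pb_snd v q n (free_eval D_algebra n (free_unit n x))).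
  by rewrite free_unitE.
rewrite -[LHS]/(oocomp q (pb_snd v q) n (free_eval D_algebra n x)) -pb_comm.
rewrite -[RHS]/(v n (oofunctor_id _ n x)) -free_eval_id; congr (v n _).
apply: (@eval_morph D_algebra free_algebra d); last exact: free_term_wf.
- by [].
- by move=> z; rewrite /= /D_point; case: cid.
- by move=> m a b z /D_fillP[].
Qed.

End FreeLifting.

Lemma free_unit_cofibration : cofibration free_unit.
Proof. by move=> Y Z q qtf u v uv; exact: (free_lifting qtf uv). Qed.

End Factorization.

Theorem cofibration_trivial_fibration_factorization (A W : oocat) (j : oofunctor A W) :
  exists (B : oocat) (i : oofunctor A B) (p : oofunctor B W),
    [/\ cofibration i, trivial_fibration p & oofunctor_eq (oocomp p i) j].
Proof.
exists (free_oocat j), (free_unit j), (free_proj j); split.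
- exact: free_unit_cofibration.
- exact: free_proj_trivial_fibration.
- exact: (@la_comm _ _ _ (free_algebra j)).
Qed.

Lemma polygraphic_resolution_exists (X : oocat) :
  exists (P : oocat) (p : oofunctor P X), polygraphic_resolution p.
Proof.
have [P [i [p [icof ptf _]]]] := cofibration_trivial_fibration_factorization (from_oo0 X).
exists P, p; split=> // Y Z q qtf u v uv.
have E : from_oo0 P = i by apply: oofunctor_ext => n [].
by rewrite E in uv *; exact: icof.
Qed.
(** * Equivalences of categories *)

Section SetoidCategories.

Lemma heq_refl (C : category) (a b : obj C) (f : hom a b) : heq f f.
Proof. exact: (@Equivalence_Reflexive _ _ (heq_equiv _ _)). Qed.

Lemma heq_sym (C : category) (a b : obj C) (f g : hom a b) : heq f g -> heq g f.
Proof. exact: (@Equivalence_Symmetric _ _ (heq_equiv _ _)). Qed.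

Lemma heq_trans (C : category) (a b : obj C) (f g h : hom a b) :
  heq f g -> heq g h -> heq f h.
Proof. exact: (@Equivalence_Transitive _ _ (heq_equiv _ _)). Qed.

Lemma hcomp_l (C : category) (a b c : obj C) (g g' : hom b c) (f : hom a b) :
  heq g g' -> heq (hcomp g f) (hcomp g' f).
Proof. by move=> gg'; apply: hcomp_heq => //; exact: heq_refl. Qed.

Lemma hcomp_r (C : category) (a b c : obj C) (g : hom b c) (f f' : hom a b) :
  heq f f' -> heq (hcomp g f) (hcomp g f').
Proof. by move=> ff'; apply: hcomp_heq => //; exact: heq_refl. Qed.

Lemma is_iso_id (C : category) (a : obj C) : is_iso (hid a).
Proof. by exists (hid a); split; exact: hcomp_idl. Qed.

Lemma is_iso_comp (C : category) (a b c : obj C) (g : hom b c) (f : hom a b) :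
  is_iso g -> is_iso f -> is_iso (hcomp g f).
Proof.
move=> [g' [g'g gg']] [f' [f'f ff']]; exists (hcomp f' g'); split.
- apply: heq_trans (hcompA _ _ _) _; apply: heq_trans (hcomp_r _ _) f'f.
  apply: heq_trans (heq_sym (hcompA _ _ _)) _.
  exact: heq_trans (hcomp_l _ g'g) (hcomp_idl _).
- apply: heq_trans (hcompA _ _ _) _; apply: heq_trans (hcomp_r _ _) gg'.
  apply: heq_trans (heq_sym (hcompA _ _ _)) _.
  exact: heq_trans (hcomp_l _ ff') (hcomp_idl _).
Qed.

Lemma is_iso_fhom (C D : category) (F : functor C D) (a b : obj C) (f : hom a b) :
  is_iso f -> is_iso (fhom F f).
Proof.
move=> [g [gf fg]]; exists (fhom F g); split.
- apply: heq_trans (heq_sym (fhom_comp _ _ _)) _.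
  exact: heq_trans (fhom_heq _ gf) (fhom_id _ _).
- apply: heq_trans (heq_sym (fhom_comp _ _ _)) _.
  exact: heq_trans (fhom_heq _ fg) (fhom_id _ _).
Qed.

Lemma nat_iso_sym (C D : category) (F G : functor C D) :
  naturally_isomorphic F G -> naturally_isomorphic G F.
Proof.
move=> [eta [eta_iso eta_nat]].
pose inv a := projT1 (cid (eta_iso a)).
have invl a : heq (hcomp (inv a) (eta a)) (hid _) by rewrite /inv; case: cid => g [].
have invr a : heq (hcomp (eta a) (inv a)) (hid _) by rewrite /inv; case: cid => g [].
exists inv; split=> [a|a b f]; first by exists (eta a).
apply: heq_trans (hcomp_r _ (heq_sym (hcomp_idr _))) _.
apply: heq_trans (hcomp_r _ (hcomp_r _ (heq_sym (invr a)))) _.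
apply: heq_trans (hcomp_r _ (heq_sym (hcompA _ _ _))) _.
apply: heq_trans (hcomp_r _ (hcomp_l _ (heq_sym (eta_nat _ _ f)))) _.
apply: heq_trans (hcomp_r _ (hcompA _ _ _)) _.
apply: heq_trans (heq_sym (hcompA _ _ _)) _.
exact: heq_trans (hcomp_l _ (invl b)) (hcomp_idl _).
Qed.

Lemma nat_iso_trans (C D : category) (F G H : functor C D) :
  naturally_isomorphic F G -> naturally_isomorphic G H -> naturally_isomorphic F H.
Proof.
move=> [eta [eta_iso eta_nat]] [mu [mu_iso mu_nat]].
exists (fun a => hcomp (mu a) (eta a)); split=> [a|a b f]; first exact: is_iso_comp.
apply: heq_trans (hcompA _ _ _) _.
apply: heq_trans (hcomp_r _ (eta_nat _ _ f)) _.
apply: heq_trans (heq_sym (hcompA _ _ _)) _.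
apply: heq_trans (hcomp_l _ (mu_nat _ _ f)) _.
exact: hcompA.
Qed.

Lemma nat_iso_postcomp (C D E : category) (H : functor D E) (F G : functor C D) :
  naturally_isomorphic F G ->
  naturally_isomorphic (comp_functor H F) (comp_functor H G).
Proof.
move=> [eta [eta_iso eta_nat]]; exists (fun a => fhom H (eta a)).
split=> [a|a b f]; first exact: (is_iso_fhom H (eta_iso a)).
apply: heq_trans (heq_sym (fhom_comp H _ _)) _.
exact: heq_trans (fhom_heq _ (eta_nat _ _ f)) (fhom_comp _ _ _).
Qed.

Lemma nat_iso_precomp (C D E : category) (H : functor C D) (F G : functor D E) :
  naturally_isomorphic F G ->
  naturally_isomorphic (comp_functor F H) (comp_functor G H).
Proof.
move=> [eta [eta_iso eta_nat]]; exists (fun a => eta (H a)).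
by split=> [a|a b f]; [exact: eta_iso|exact: eta_nat].
Qed.

Lemma is_equivalence_nat_iso (C D : category) (F G : functor C D) :
  naturally_isomorphic F G -> is_equivalence F -> is_equivalence G.
Proof.
move=> FG [H [HF FH]]; exists H; split.
- by apply: nat_iso_trans HF; apply: nat_iso_postcomp; exact: nat_iso_sym.
- by apply: nat_iso_trans FH; apply: nat_iso_precomp; exact: nat_iso_sym.
Qed.

(** Equivalences are the functors that are invertible up to natural
    isomorphism, so the three properties are those of invertible arrows in a
    category. *)
Section TwoOfThree.
Variables (C D E : category) (G : functor C D) (F : functor D E).

Lemma is_equivalence_comp :
  is_equivalence F -> is_equivalence G -> is_equivalence (comp_functor F G).
Proof.
move=> [F' [F'F FF']] [G' [G'G GG']]; exists (comp_functor G' F'); split.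
- apply: nat_iso_trans G'G.
  exact: (nat_iso_postcomp G' (nat_iso_precomp G F'F)).
- apply: nat_iso_trans FF'.
  exact: (nat_iso_postcomp F (nat_iso_precomp F' GG')).
Qed.

Lemma is_equivalence_right :
  is_equivalence F -> is_equivalence (comp_functor F G) -> is_equivalence G.
Proof.
move=> [F' [F'F FF']] [H [HFG FGH]]; exists (comp_functor H F); split=> //.
apply: nat_iso_trans (F'F).
apply: nat_iso_trans (nat_iso_sym (nat_iso_precomp (comp_functor G (comp_functor H F)) F'F)) _.
exact: (nat_iso_postcomp F' (nat_iso_precomp F FGH)).
Qed.

Lemma is_equivalence_left :
  is_equivalence G -> is_equivalence (comp_functor F G) -> is_equivalence F.
Proof.
move=> [G' [G'G GG']] [H [HFG FGH]]; exists (comp_functor G H); split=> //.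
apply: nat_iso_trans (GG').
apply: nat_iso_trans (nat_iso_sym (nat_iso_postcomp (comp_functor (comp_functor G H) F) GG')) _.
exact: (nat_iso_postcomp G (nat_iso_precomp G' HFG)).
Qed.

End TwoOfThree.
End SetoidCategories.

Lemma Pi1_functor_comp (X'' X' X : oocat) (f : oofunctor X' X) (g : oofunctor X'' X') :
  naturally_isomorphic (Pi1_functor (oocomp f g))
    (comp_functor (Pi1_functor f) (Pi1_functor g)).
Proof.
have mapE a b (u : @hom (Pi1 X'') a b) :
    fhom (Pi1_functor (oocomp f g)) u = fhom (Pi1_functor f) (fhom (Pi1_functor g) u).
  have arrE x y (v : arrow x y) :
      c1_map (oocomp f g) v = c1_map f (c1_map g v).
    by congr exist; exact: Prop_irrelevance.
  elim: u => {a b} //= [a b v|a b v|a b c v IHv w IHw].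
  - by rewrite arrE.
  - by rewrite arrE.
  - by rewrite IHv IHw.
exists (fun a => hid (c0 := Pi1 X) (f 0 (g 0 a))); split=> [a|a b u].
  exact: is_iso_id.
rewrite mapE; exact: heq_trans (hcomp_idl _) (heq_sym (hcomp_idr _)).
Qed.
(** * Homology and change of coefficients *)

Local Open Scope ring_scope.

Section AdditiveInverse.
Variables (V W : zmodType) (f : {additive V -> W}) (f_bij : bijective f).

Let inv_ex (w : W) : exists v, f v = w.
Proof. by have [g _ gK] := f_bij; exists (g w). Qed.

Let inv_fun (w : W) : V := projT1 (cid (inv_ex w)).

Let inv_funK : cancel inv_fun f.
Proof. by move=> w; rewrite /inv_fun; case: cid. Qed.

Let inv_is_zmod_morphism : zmod_morphism inv_fun.
Proof. by move=> w w'; apply: (bij_inj f_bij); rewrite raddfB !inv_funK. Qed.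

HB.instance Definition _ := GRing.isZmodMorphism.Build W V inv_fun inv_is_zmod_morphism.

Definition additive_inv : {additive W -> V} := inv_fun.

Lemma additive_invK : cancel additive_inv f. Proof. exact: inv_funK. Qed.

Lemma additive_Kinv : cancel f additive_inv.
Proof. by move=> v; apply: (bij_inj f_bij); rewrite additive_invK. Qed.

End AdditiveInverse.

Section HomologyFunctoriality.

Lemma homology_map_class (C D : chain_complex) (f : chain_map C D) n (z : cycles C n) :
  homology_map f n (\pi_(Quotient.quot (boundary_pred C n))%qT z) =
  \pi_(Quotient.quot (boundary_pred D n))%qT (cycle_map f z).
Proof. exact: quot_liftE. Qed.

(** Stated for any h that agrees with g \o f, since the composites met below
    are only pointwise equal to given chain maps. *)
Lemma homology_map_comp (C D E : chain_complex) (f : chain_map C D)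
    (g : chain_map D E) (h : chain_map C E) :
  (forall n c, h n c = g n (f n c)) ->
  forall n x, homology_map h n x = homology_map g n (homology_map f n x).
Proof.
move=> hgf n x; rewrite -[x]reprK; move: (repr x) => {x} z.
rewrite (homology_map_class h) (homology_map_class f) (homology_map_class g).
by congr (\pi_ _)%qT; apply: val_inj; rewrite /= hgf.
Qed.

Definition chain_map_comp (C D E : chain_complex) (g : chain_map D E)
  (f : chain_map C D) : chain_map C E.
Proof.
refine (@ChainMap C E (fun n => g n \o f n) _).
by move=> n c; rewrite /= !chain_mapP.
Defined.

Lemma homology_map_id (C : chain_complex) (f : chain_map C C) :
  (forall n c, f n c = c) -> forall n x, homology_map f n x = x.
Proof.
move=> fE n x; rewrite -[x]reprK; move: (repr x) => {x} z; rewrite !homology_map_class.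
by congr (\pi_ _)%qT; apply: val_inj; rewrite /= fE.
Qed.

Lemma homology_map_bij (C D : chain_complex) (f : chain_map C D) (g : chain_map D C) :
  (forall n c, g n (f n c) = c) -> (forall n c, f n (g n c) = c) ->
  forall n, bijective (homology_map f n).
Proof.
have id_map (E : chain_complex) : {i : chain_map E E | forall n c, i n c = c}.
  by exists (@ChainMap E E (fun n => idfun) (fun n c => erefl)).
move=> gf fg n; exists (homology_map g n) => x.
- have [i iE] := id_map C.
  by rewrite -(homology_map_comp (h := i)) ?(homology_map_id iE) // => k c; rewrite gf iE.
- have [i iE] := id_map D.
  by rewrite -(homology_map_comp (h := i)) ?(homology_map_id iE) // => k c; rewrite fg iE.
Qed.

End HomologyFunctoriality.

Record ls_hom (X : oocat) (M N : local_system X) : Type := LsHom {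
  ls_fun :> forall y : cell X 0, {additive fib M y -> fib N y};
  ls_pull : forall (x : cell X 1) (y0 y1 : cell X 0) (hs : s0 x = y0) (ht : t0 x = y1) m,
    ls_fun y0 (pull M x hs ht m) = pull N x hs ht (ls_fun y1 m)
}.

Section ChainsCoefficients.
Variables (X : oocat) (M N : local_system X) (a : ls_hom M N).

Let coef n (x : cell X n) : {additive fib M (t0 x) -> chain_group N n} :=
  (cls (M := N) x erefl \o a (t0 x)).

Let coef_gen n (x : cell X n) (y : cell X 0) (e : t0 x = y) (m : fib M y) :
  chain_sum_lift (@coef n) (gen (M := M) x e m) = cls (M := N) x e (a y m).
Proof. by rewrite chain_sum_lift_gen; case: y / e m. Qed.

Lemma coef_compatible n : chain_compatible (@coef n).
Proof.
move=> c c'; elim=> {c c'}; last first.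
- by move=> c c' b b' _ IHc _ IHb; rewrite !raddfD IHc IHb.
- by move=> c c' c'' _ -> _ ->.
- by move=> c c' _ ->.
- by [].
- move=> i i0 h x1 x0 e y et et1 et0 m; rewrite raddfD !coef_gen.
  exact: cls_comp.
- move=> h x1 x0 e y0 y1 et et1 et0 hs ht m; rewrite raddfD !coef_gen ls_pull.
  exact: cls_comp0.
Qed.

Definition chains_coef_fun n : {additive chain_group M n -> chain_group N n} :=
  chain_lift (@coef_compatible n).

Lemma chains_coef_cls n (x : cell X n) (y : cell X 0) (e : t0 x = y) (m : fib M y) :
  chains_coef_fun n (cls (M := M) x e m) = cls (M := N) x e (a y m).
Proof. by rewrite /chains_coef_fun chain_lift_cls; case: y / e m. Qed.

Lemma chains_coefP n (c : chain_group M n.+1) :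
  chains_coef_fun n (chain_diff M n c) = chain_diff N n (chains_coef_fun n.+1 c).
Proof.
have := @chain_ext _ _ _ _ (chains_coef_fun n \o chain_diff M n)
  (chain_diff N n \o chains_coef_fun n.+1) _ c; apply.
move=> {c} x y e m.
rewrite -[LHS]/(chains_coef_fun n (chain_diff M n (cls (M := M) x e m))).
rewrite -[RHS]/(chain_diff N n (chains_coef_fun n.+1 (cls (M := M) x e m))).
rewrite chains_coef_cls; case: n x e => [|n] x e.
  have e1 : t0 (t0 x) = y by rewrite t0_id.
  have e0 : t0 (s0 x) = s0 x by exact: t0_id.
  rewrite (chain_diff0 e e1 e0 erefl) raddfB !chains_coef_cls.
  by rewrite (chain_diff0 e e1 e0 erefl) ls_pull.
have et : t0 (tgt (leqnSn n.+1) x) = y by rewrite t0_tgt.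
have es : t0 (src (leqnSn n.+1) x) = y by rewrite t0_src.
by rewrite (chain_diffS e et es) (chain_diffS e et es) raddfB !chains_coef_cls.
Qed.

Definition chains_coef : chain_map (chains M) (chains N) :=
  @ChainMap (chains M) (chains N) chains_coef_fun chains_coefP.

End ChainsCoefficients.

Section InverseHom.
Variables (X : oocat) (M N : local_system X) (a : ls_hom M N).
Hypothesis a_bij : forall y, bijective (a y).

Let inv y : {additive fib N y -> fib M y} := additive_inv (a_bij y).

Let inv_pull (x : cell X 1) (y0 y1 : cell X 0) (hs : s0 x = y0) (ht : t0 x = y1) m :
  inv y0 (pull N x hs ht m) = pull M x hs ht (inv y1 m).
Proof. by apply: (bij_inj (a_bij y0)); rewrite ls_pull !additive_invK. Qed.

Definition ls_inv : ls_hom N M := LsHom inv_pull.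

Lemma chains_coef_bij n : bijective (homology_map (chains_coef a) n).
Proof.
have coefK (K L : local_system X) (k : ls_hom K L) (l : ls_hom L K) :
    (forall y, cancel (k y) (l y)) ->
    forall m (c : chain_group K m), chains_coef l m (chains_coef k m c) = c.
  move=> kl m.
  apply: (@chain_ext _ _ _ _ (chains_coef_fun l m \o chains_coef_fun k m) idfun).
  move=> x y e z.
  rewrite -[LHS]/(chains_coef_fun l m (chains_coef_fun k m (cls x e z))).
  by rewrite !chains_coef_cls kl.
apply: (@homology_map_bij _ _ _ (chains_coef ls_inv)); apply: coefK => y.
- exact: additive_Kinv.
- exact: additive_invK.
Qed.

End InverseHom.

Definition ls_isom (X : oocat) (M N : local_system X) : Prop :=
  exists a : ls_hom M N, forall y, bijective (a y).

Lemma ls_isom_sym (X : oocat) (M N : local_system X) : ls_isom M N -> ls_isom N M.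
Proof.
move=> [a a_bij]; exists (ls_inv a_bij) => y.
by exists (a y); [exact: additive_invK|exact: additive_Kinv].
Qed.

Lemma ls_isom_trans (X : oocat) (M N L : local_system X) :
  ls_isom M N -> ls_isom N L -> ls_isom M L.
Proof.
move=> [a a_bij] [b b_bij].
have ba_pull (x : cell X 1) (y0 y1 : cell X 0) (hs : s0 x = y0) (ht : t0 x = y1) m :
    (b y0 \o a y0) (pull M x hs ht m) = pull L x hs ht ((b y1 \o a y1) m).
  by rewrite /= !ls_pull.
by exists (@LsHom _ M L (fun y => b y \o a y) ba_pull) => y; exact: bij_comp.
Qed.

Definition ls_hom_inverse_image (X' X : oocat) (f : oofunctor X' X)
    (M N : local_system X) (a : ls_hom M N) :
    ls_hom (inverse_image f M) (inverse_image f N).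
Proof.
refine (@LsHom _ (inverse_image f M) (inverse_image f N) (fun y => a (f 0%N y)) _).
by move=> x y0 y1 hs ht m; exact: (ls_pull a (inv_fib_src f hs) (inv_fib_tgt f ht)).
Defined.

Lemma ls_isom_inverse_image (X' X : oocat) (f : oofunctor X' X)
    (M N : local_system X) :
  ls_isom M N -> ls_isom (inverse_image f M) (inverse_image f N).
Proof.
by move=> [a a_bij]; exists (ls_hom_inverse_image f a) => y; exact: a_bij.
Qed.

Section InverseImageComp.
Variables (X'' X' X : oocat) (f : oofunctor X' X) (g : oofunctor X'' X').
Variable M : local_system X.

(** Both local systems have the same fibres and the same action; only the
    proofs that the ends of a 1-cell are the expected ones differ. *)
Definition ls_comp_hom :
  ls_hom (inverse_image g (inverse_image f M)) (inverse_image (oocomp f g) M).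
Proof.
refine (@LsHom _ (inverse_image g (inverse_image f M)) (inverse_image (oocomp f g) M)
  (fun y => idfun) _).
by move=> x y0 y1 hs ht m; apply: (@pull_eq _ M).
Defined.

Lemma ls_isom_comp :
  ls_isom (inverse_image g (inverse_image f M)) (inverse_image (oocomp f g) M).
Proof. by exists ls_comp_hom => y; exists idfun. Qed.

End InverseImageComp.

Lemma bij_square (B B' D D' : Type) (k : B -> D) (k' : B' -> D')
    (b : B -> B') (d : D -> D') :
  bijective b -> bijective d -> (forall x, k' (b x) = d (k x)) ->
  bijective k -> bijective k'.
Proof.
move=> bbij dbij sq kbij.
have [b' bK b'K] := bbij.
apply: (eq_bij (bij_comp dbij (bij_comp kbij (Bijective b'K bK)))).
by move=> x /=; rewrite -sq b'K.
Qed.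

Lemma chains_map_bij_isom (Y' Y : oocat) (f : oofunctor Y' Y) (M N : local_system Y)
    (n : nat) :
  ls_isom M N -> bijective (homology_map (chains_map f M) n) ->
  bijective (homology_map (chains_map f N) n).
Proof.
move=> [a a_bij]; pose a' := ls_hom_inverse_image f a.
have a'_bij y : bijective (a' y) by exact: a_bij.
apply: bij_square (chains_coef_bij a'_bij n) (chains_coef_bij a_bij n) _ => x.
rewrite -(homology_map_comp (f := chains_map f M) (g := chains_coef a)
  (h := chain_map_comp (chains_coef a) (chains_map f M))) //.
apply: esym; apply: homology_map_comp => m.
apply: (@chain_ext _ _ _ _ (chains_coef_fun a m \o chains_map_fun f M m)
  (chains_map_fun f N m \o chains_coef_fun a' m)) => z y e k.
rewrite -[LHS]/(chains_coef_fun a m (chains_map_fun f M m (cls z e k))).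
rewrite -[RHS]/(chains_map_fun f N m (chains_coef_fun a' m (cls z e k))).
have e' : t0 (f m z) = f 0%N y by rewrite -e fmap_t0.
rewrite (chains_map_cls e e') (chains_coef_cls a e' k).
by rewrite (chains_coef_cls a' e k) (chains_map_cls e e').
Qed.

Lemma chains_map_oocomp (Y'' Y' Y : oocat) (f : oofunctor Y' Y) (g : oofunctor Y'' Y')
    (M : local_system Y) (n : nat)
    (x : homology (chains (inverse_image g (inverse_image f M))) n) :
  homology_map (chains_map (oocomp f g) M) n
    (homology_map (chains_coef (ls_comp_hom f g M)) n x) =
  homology_map (chains_map f M) n (homology_map (chains_map g (inverse_image f M)) n x).
Proof.
pose h := chain_map_comp (chains_map f M) (chains_map g (inverse_image f M)).
rewrite -(homology_map_comp (f := chains_map g (inverse_image f M))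
  (g := chains_map f M) (h := h)) //; apply: esym; apply: homology_map_comp => m.
apply: (@chain_ext _ _ _ _ (chains_map_fun f M m \o chains_map_fun g (inverse_image f M) m)
  (chains_map_fun (oocomp f g) M m \o chains_coef_fun (ls_comp_hom f g M) m)) => z y e k.
rewrite -[LHS]/(chains_map_fun f M m
  (chains_map_fun g (inverse_image f M) m (cls z e k))).
rewrite -[RHS]/(chains_map_fun (oocomp f g) M m
  (chains_coef_fun (ls_comp_hom f g M) m (cls z e k))).
have e' : t0 (g m z) = g 0%N y by rewrite -e fmap_t0.
have e'' : t0 (f m (g m z)) = f 0%N (g 0%N y) by rewrite -e' fmap_t0.
rewrite (chains_map_cls (M := inverse_image f M) e e') (chains_map_cls e' e'').
by rewrite (chains_coef_cls _ e k) (chains_map_cls (f := oocomp f g) e e'').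
Qed.

(** * Local systems and the fundamental groupoid *)

(** A local system extends to a contravariant functor on the fundamental
    groupoid, formal inverses acting by the inverse isomorphisms. *)
Section Monodromy.
Variables (X : oocat) (M : local_system X).

Fixpoint monodromy (x y : obj (c1 X)) (u : lhom x y) : {additive fib M y -> fib M x} :=
  match u in lhom x y return {additive fib M y -> fib M x} with
  | l_arr _ _ f => pull M (proj1_sig f) (proj2_sig f).1 (proj2_sig f).2
  | l_inv _ _ f => additive_inv (pull_bij M (proj2_sig f).1 (proj2_sig f).2)
  | l_id _ => idfun
  | l_comp _ _ _ v u => (monodromy u \o monodromy v)
  end.

Let pull_zigzag (f g : cell X 1) (x y : cell X 0) hs ht hs' ht' m :
  clos_refl_sym_trans _ (@two_cell X) f g ->
  pull M f (x0 := x) (x1 := y) hs ht m = pull M g hs' ht' m.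
Proof.
move=> fg; elim: fg hs ht hs' ht' => {f g}.
- by move=> f g fg hs ht hs' ht'; exact: pull_two_cell.
- by move=> f hs ht hs' ht'; exact: pull_eq.
- by move=> f g _ IH hs ht hs' ht'; rewrite -(IH hs' ht' hs ht).
- move=> f g h fg IHfg gh IHgh hs ht hs' ht'.
  have [E1 E2] := zigzag_ends fg.
  have hs1 : s0 g = x by rewrite -E1.
  have ht1 : t0 g = y by rewrite -E2.
  by rewrite (IHfg hs ht hs1 ht1) (IHgh hs1 ht1 hs' ht').
Qed.

Lemma monodromy_heq (x y : obj (c1 X)) (u v : lhom x y) :
  lhom_eq u v -> monodromy u =1 monodromy v.
Proof.
elim=> {x y u v} //=.
- by move=> x y u v _ E m; rewrite E.
- by move=> x y u v w _ E _ E' m; rewrite E E'.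
- by move=> x y z v v' u u' _ Ev _ Eu m /=; rewrite Ev Eu.
- by move=> x y f g fg m; exact: pull_zigzag.
- by move=> x m; exact: pull_unit.
- move=> x y z g f m; exact: pull_comp.
- by move=> x y f m; exact: (additive_invK (pull_bij M (proj2_sig f).1 (proj2_sig f).2)).
- by move=> x y f m; exact: (additive_Kinv (pull_bij M (proj2_sig f).1 (proj2_sig f).2)).
Qed.

Lemma monodromy_bij (x y : obj (c1 X)) (u : lhom x y) : bijective (monodromy u).
Proof.
elim: u => {x y} [x y f|x y f|x|x y z v IHv u IHu] /=.
- exact: pull_bij.
- by exists (pull M (proj1_sig f) (proj2_sig f).1 (proj2_sig f).2);
    [exact: additive_invK|exact: additive_Kinv].
- by exists idfun.
- exact: bij_comp.
Qed.

End Monodromy.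
Arguments monodromy_heq {X} M [x y u v] _.

(** A functor between fundamental groupoids pulls local systems back, even
    when it does not come from an oo-functor. *)
Section Transfer.
Variables (X' X : oocat) (G : functor (Pi1 X) (Pi1 X')) (M : local_system X').

Let arr (x : cell X 1) (x0 x1 : cell X 0) (hs : s0 x = x0) (ht : t0 x = x1) :
  @hom (Pi1 X) x0 x1 :=
  @l_arr (c1 X) x0 x1 (exist _ x (conj hs ht)).

Let tfib (x : cell X 0) : zmodType := fib M (G x).

Let tpull (x : cell X 1) (x0 x1 : cell X 0) (hs : s0 x = x0) (ht : t0 x = x1) :
  {additive tfib x1 -> tfib x0} := monodromy M (fhom G (arr hs ht)).

Definition transfer : local_system X.
Proof.
refine (@LocalSystem X tfib tpull _ _ _ _).
- move=> y hs ht m; rewrite /tpull.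
  transitivity (monodromy M (fhom G (hid (c0 := Pi1 X) y)) m).
    apply: monodromy_heq; apply: (fhom_heq G); apply: le_trans (le_arr_id _).
    apply: le_arr_heq; exact: rst_refl.
  by rewrite (monodromy_heq M (fhom_id G y)).
- move=> h x1 x0 e y0 y1 y2 hs ht hs0 ht0 hs1 ht1 m.
  transitivity (monodromy M
      (fhom G (hcomp (c0 := Pi1 X) (arr hs1 ht1) (arr hs0 ht0))) m).
    apply: monodromy_heq; apply: (fhom_heq G); apply: le_trans (le_arr_comp _ _).
    apply: le_arr_heq; rewrite /= /arrow_eq /=.
    set c := (X in clos_refl_sym_trans _ _ _ X).
    have -> : c = comp h x1 x0 e by exact: comp_irr.
    exact: rst_refl.
  by rewrite (monodromy_heq M (fhom_comp G _ _)).
- move=> x x' y0 y1 hs ht hs' ht' m xx'; apply: monodromy_heq; apply: (fhom_heq G).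
  by apply: le_arr_heq; exact: rst_step.
- by move=> x y0 y1 hs ht; exact: monodromy_bij.
Defined.

End Transfer.

(** Transfer M along a quasi-inverse G of [Pi1_functor f].  The unit of the
    equivalence is a natural family of arrows y -> G (f y) of the fundamental
    groupoid of X', and its monodromy is the isomorphism. *)
Lemma inverse_image_ess_surj (X' X : oocat) (f : oofunctor X' X) (M : local_system X') :
  is_equivalence (Pi1_functor f) ->
  exists N : local_system X, ls_isom (inverse_image f N) M.
Proof.
move=> [G [GF _]]; have [eta [_ eta_nat]] := nat_iso_sym GF.
exists (transfer G M).
pose a (y : cell X' 0) : {additive fib (inverse_image f (transfer G M)) y -> fib M y} :=
  monodromy M (eta y).
have a_nat (x : cell X' 1) (y0 y1 : cell X' 0) (hs : s0 x = y0) (ht : t0 x = y1) m :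
    a y0 (pull (inverse_image f (transfer G M)) x hs ht m) = pull M x hs ht (a y1 m).
  pose u : @hom (Pi1 X') y0 y1 := @l_arr (c1 X') y0 y1 (exist _ x (conj hs ht)).
  have E : pull M x hs ht (a y1 m) =
           a y0 (monodromy M (fhom G (fhom (Pi1_functor f) u)) m).
    apply: etrans (monodromy_heq M (eta_nat y0 y1 u) m); exact: pull_eq.
  rewrite E; congr (a y0 _).
  pose u' : @hom (Pi1 X) (f 0%N y0) (f 0%N y1) := @l_arr (c1 X) _ _
    (exist _ (f 1%N x) (conj (inv_fib_src f hs) (inv_fib_tgt f ht))).
  have uu' : heq u' (fhom (Pi1_functor f) u) by apply: le_arr_heq; exact: rst_refl.
  exact: (monodromy_heq M (fhom_heq G uu') m).
by exists (LsHom a_nat) => y; exact: monodromy_bij.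
Qed.

(** * The 2-out-of-3 property *)

Lemma bij_of_compr (A B C : Type) (f : B -> C) (g : A -> B) :
  bijective g -> bijective (f \o g) -> bijective f.
Proof.
move=> gbij fgbij; have [g' gK g'K] := gbij.
apply: (eq_bij (bij_comp fgbij (Bijective g'K gK))).
by move=> x /=; rewrite g'K.
Qed.

Lemma bij_of_compl (A B C : Type) (f : B -> C) (g : A -> B) :
  bijective f -> bijective (f \o g) -> bijective g.
Proof.
move=> fbij fgbij; have [f' fK f'K] := fbij.
apply: (eq_bij (bij_comp (Bijective f'K fK) fgbij)).
by move=> x /=; rewrite fK.
Qed.

Section ChainsTwoOfThree.
Variables (Y'' Y' Y : oocat) (f : oofunctor Y' Y) (g : oofunctor Y'' Y').
Variables (M : local_system Y) (n : nat).

Let Hf := homology_map (chains_map f M) n.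
Let Hg := homology_map (chains_map g (inverse_image f M)) n.
Let Hfg := homology_map (chains_map (oocomp f g) M) n.

Let coef_bij : bijective (homology_map (chains_coef (ls_comp_hom f g M)) n).
Proof. by apply: chains_coef_bij => y; exists idfun. Qed.

(** Going from g^* f^* M to (f \o g)^* M, as coefficients of the source, is the
    bijection that makes the comparison possible. *)
Lemma chains_comp_bij : bijective Hfg <-> bijective (Hf \o Hg).
Proof.
have E : Hf \o Hg =1 Hfg \o homology_map (chains_coef (ls_comp_hom f g M)) n.
  by move=> x; exact: esym (chains_map_oocomp _).
split=> [fg|fg]; first by apply: (eq_bij (bij_comp fg coef_bij)) => x; exact: esym (E x).
by apply: (bij_of_compr coef_bij); apply: (eq_bij fg) => x; exact: E.
Qed.

End ChainsTwoOfThree.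

(** For a lift ft of f, the coefficients on P' obtained through P and through
    X' are the same up to isomorphism. *)
Lemma inverse_image_square (P' P X' X : oocat) (p' : oofunctor P' X')
    (p : oofunctor P X) (ft : oofunctor P' P) (f : oofunctor X' X) (M : local_system X) :
  oofunctor_eq (oocomp p ft) (oocomp f p') ->
  ls_isom (inverse_image ft (inverse_image p M))
    (inverse_image p' (inverse_image f M)).
Proof.
move=> sq; apply: ls_isom_trans (ls_isom_comp p ft M) _.
by rewrite (oofunctor_ext sq); apply: ls_isom_sym; exact: ls_isom_comp.
Qed.

Lemma resolution_lift (P' P X' X : oocat) (p' : oofunctor P' X')
    (p : oofunctor P X) (f : oofunctor X' X) :
  polygraph P' -> trivial_fibration p ->
  exists ft : oofunctor P' P, oofunctor_eq (oocomp p ft) (oocomp f p').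
Proof.
move=> P'pol ptf.
have [|ft [_ pft]] := P'pol P X p ptf (from_oo0 P) (oocomp f p'); first by move=> n [].
by exists ft.
Qed.

Theorem proposition4p11 (X'' X' X : oocat)
    (g : oofunctor X'' X') (f : oofunctor X' X) (h : oofunctor X'' X)
    (hfg : oofunctor_eq h (oocomp f g)) :
  (polygraphic_equivalence f -> polygraphic_equivalence g ->
     polygraphic_equivalence h) /\
  (polygraphic_equivalence f -> polygraphic_equivalence h ->
     polygraphic_equivalence g) /\
  (polygraphic_equivalence g -> polygraphic_equivalence h ->
     polygraphic_equivalence f).
Proof.
rewrite {hfg}(oofunctor_ext hfg).
have PiE := Pi1_functor_comp f g.
split; [|split].
- move=> [fPi fH] [gPi gH]; split.
    exact: is_equivalence_nat_iso (nat_iso_sym PiE) (is_equivalence_comp fPi gPi).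
  move=> M n P'' P p'' p ht [P''pol p''tf] [Ppol ptf] sq.
  (* The map P'' -> X' x_X P remembers both g p'' and ht; P' is the middle of
     its factorization, which is cofibrant because P'' is. *)
  have sq' : oofunctor_eq (oocomp f (oocomp g p'')) (oocomp p ht).
    by move=> m x; exact: esym (sq m x).
  have [P' [i [r [icof rtf ri]]]] :=
    cofibration_trivial_fibration_factorization (pb_pair sq').
  pose p' := oocomp (pb_fst f p) r; pose ft := oocomp (pb_snd f p) r.
  have p'res : polygraphic_resolution p'.
    split; last first.
      apply: trivial_fibration_comp rtf; apply: cell_lifting_trivial_fibration.
      by apply: pullback_cell_lifting; exact: trivial_fibration_cell_lifting.
    have -> : polygraph P' = cofibration (oocomp i (from_oo0 P'')).
      by congr cofibration; apply: oofunctor_ext => m [].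
    exact: cofibration_comp.
  have htE : oocomp ft i = ht.
    rewrite -[RHS](pb_pair_snd sq') -(oofunctor_ext ri).
    exact: oofunctor_ext.
  have fsq : oofunctor_eq (oocomp p ft) (oocomp f p').
    move=> m x; exact: (esym (congr1 (fun F : oofunctor _ _ => F m (r m x)) (pb_comm f p))).
  have gsq : oofunctor_eq (oocomp p' i) (oocomp g p'').
    by move=> m x; exact: (congr1 (pb_fst f p m) (ri m x)).
  rewrite -htE; apply/chains_comp_bij; apply: bij_comp.
    exact: (fH M n P' P p' p ft).
  apply: chains_map_bij_isom (gH (inverse_image f M) n P'' P' p'' p' i _ _ gsq) => //.
  by apply: ls_isom_sym; exact: inverse_image_square.
- move=> [fPi fH] [hPi hH]; split.
    exact: is_equivalence_right fPi (is_equivalence_nat_iso PiE hPi).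
  move=> M' n P'' P' p'' p' gt p''res p'res gsq.
  have [M isoM] := inverse_image_ess_surj M' fPi.
  have [P [p pres]] := polygraphic_resolution_exists X.
  have [ft fsq] := resolution_lift p' f p'res.1 pres.2.
  have hsq : oofunctor_eq (oocomp p (oocomp ft gt)) (oocomp (oocomp f g) p'').
    by move=> m x; rewrite -[LHS]/(oocomp p ft m (gt m x)) fsq /=; congr (f m _); exact: gsq.
  have /chains_comp_bij := hH M n P'' P p'' p (oocomp ft gt) p''res pres hsq.
  move=> /(bij_of_compl (fH M n P' P p' p ft p'res pres fsq)).
  apply: chains_map_bij_isom; apply: ls_isom_trans (inverse_image_square M fsq) _.
  exact: ls_isom_inverse_image.
- move=> [gPi gH] [hPi hH]; split.
    exact: is_equivalence_left gPi (is_equivalence_nat_iso PiE hPi).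
  move=> M n P' P p' p ft p'res pres fsq.
  have [P'' [p'' p''res]] := polygraphic_resolution_exists X''.
  have [gt gsq] := resolution_lift p'' g p''res.1 p'res.2.
  have hsq : oofunctor_eq (oocomp p (oocomp ft gt)) (oocomp (oocomp f g) p'').
    by move=> m x; rewrite -[LHS]/(oocomp p ft m (gt m x)) fsq /=; congr (f m _); exact: gsq.
  have /chains_comp_bij := hH M n P'' P p'' p (oocomp ft gt) p''res pres hsq.
  apply: bij_of_compr.
  apply: chains_map_bij_isom (gH (inverse_image f M) n P'' P' p'' p' gt p''res p'res gsq).
  by apply: ls_isom_sym; exact: inverse_image_square.
Qed.
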